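(* Let $n=n_1n_2\to\infty$, with $n_1,n_2,s,m,\mu$ depending on $n$ ($s\ge1$ an integer, $m>0$, $\mu>0$), such that for each $n$ the index set $\{1,\dots,n_1\}\times\{1,\dots,n_2\}$ can be covered entirely by pairwise disjoint $s$-submatrices, and suppose $s=o(n)$. Let $\mathcal{C}=\mathcal{C}_n$ be the class of $s$-submatrices. Consider adaptive sensing procedures satisfying $\mathbb{E}_S\big(\sum_j\Gamma_j\big)\le m$ for every $S\in\mathcal{C}\cup\{\emptyset\}$, together with estimators $\hat S$. (i) If $\lim_{n\to\infty}\max_{S\in\mathcal{C}\cup\{\emptyset\}}\mathbb{P}_S(\hat S\ne S)=0$, then there is a sequence $\omega_n\to\infty$ such that, for all sufficiently large $n$, $$\mu\ge\omega_n\sqrt{\frac{2n}{sm}} .$$ (ii) If $\lim_{n\to\infty}\max_{S\in\mathcal{C}\cup\{\emptyset\}}\mathbb{E}_S(|\hat S\triangle S|)=0$, then there is a sequence $\omega_n\to\infty$ such that, for all sufficiently large $n$, $$\mu\ge\sqrt{\frac{2n}{sm}\left(\log s+\omega_n\right)} .$$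
   Context: The $n=n_1n_2$ coordinates of the signal are identified with $\{1,\dots,n_1\}\times\{1,\dots,n_2\}$. An $s$-submatrix is a set $S_1\times S_2$ with $S_1\subseteq\{1,\dots,n_1\}$, $S_2\subseteq\{1,\dots,n_2\}$ and $|S_1|\cdot|S_2|=s$. Sensing model. For an unknown support set $S\subseteq\{1,\dots,n\}$ and $\mu>0$, the signal $\boldsymbol{x}\in\mathbb{R}^n$ has $x_i=\mu$ if $i\in S$ and $x_i=0$ otherwise. One collects measurements $Y_j=x_{A_j}+\Gamma_j^{-1/2}W_j$, $j=1,2,\dots$, where $A_j\in\{1,\dots,n\}$ is the measured coordinate, $\Gamma_j>0$ is the precision, and the $W_j$ are i.i.d. $\mathcal{N}(0,1)$, with $W_j$ independent of $\{A_i,\Gamma_i\}_{i\le j}$ and of the past observations. An adaptive sensing procedure chooses $(A_j,\Gamma_j)$ as a (possibly randomized) function of $\{Y_i,A_i,\Gamma_i\}_{i<j}$, and may stop at a data-dependent time (sums over $j$ run over the measurements actually made). An estimator $\hat S\subseteq\{1,\dots,n\}$ is a function of all collected data. $\mathbb{P}_S,\mathbb{E}_S$ denote probability and expectation when the support is $S$. $\triangle$ is symmetric difference. *)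

(* Defs.v *)
(* Built on MathComp and MathComp-Analysis. *)
From HB Require Import structures.
From mathcomp Require Import all_boot all_order all_algebra.
From mathcomp Require Import all_classical all_reals all_analysis.

Set Implicit Arguments.
Unset Strict Implicit.
Unset Printing Implicit Defensive.

Import Order.TTheory GRing.Theory Num.Theory.
Import numFieldNormedType.Exports.

Local Open Scope classical_set_scope.
Local Open Scope ring_scope.

(* [None] stands for "no measurement: the procedure has stopped".  The
   sigma-algebra is that of the disjoint union of a point and of one copy of D
   for each element of the finite type T. *)
Definition stop_or (T : finType) (D : Type) : Type := option (T * D).

Definition stop_or_display : measure_display -> measure_display.
Proof. exact. Qed.

Section stop_or_measurable.
Context (T : finType) (d : measure_display) (D : measurableType d).

HB.instance Definition _ := Choice.copy (stop_or T D) (option (T * D)%type).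
HB.instance Definition _ := isPointed.Build (stop_or T D) None.

Definition stop_or_measurable : set (set (stop_or T D)) :=
  [set A | forall t : T, measurable [set x : D | A (Some (t, x))]].

Lemma stop_or_measurable0 : stop_or_measurable set0.
Proof. by move=> t; exact: measurable0. Qed.

Lemma stop_or_measurableC (A : set (stop_or T D)) :
  stop_or_measurable A -> stop_or_measurable (~` A).
Proof. by move=> mA t; exact: measurableC (mA t). Qed.

Lemma stop_or_measurable_bigcup (F : (set (stop_or T D))^nat) :
  (forall i, stop_or_measurable (F i)) -> stop_or_measurable (\bigcup_i F i).
Proof.
move=> mF t; rewrite (_ : [set x | _] = \bigcup_i [set x | F i (Some (t, x))])//.
by apply: bigcup_measurable => i _; exact: mF.
Qed.

HB.instance Definition _ := @isMeasurable.Build (stop_or_display d)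
  (stop_or T D) stop_or_measurable stop_or_measurable0 stop_or_measurableC
  stop_or_measurable_bigcup.

End stop_or_measurable.

Section sensing.
Context (R : realType) (T : finType).

(* [Some (t, g)]: measure coordinate t with precision g. *)
Definition action := stop_or T (measurableTypeR R).

(* [Some (t, (g, y))]: the measurement of t with precision g returned y. *)
Definition datum := stop_or T (measurableTypeR R * measurableTypeR R)%type.

(* A randomized rule is a sequence of probability kernels: the j-th one maps
   the data of steps 0, .., j-1 to the law of the next action. It does not
   depend on the support. *)
Definition policy := forall j : nat, R.-pker (j.-tuple datum) ~> action.

Definition signal (mu : R) (S : {set T}) (t : T) : R :=
  if t \in S then mu else 0.

Definition measure_at (x : T -> R) (a : action) (w : R) : datum :=
  if a is Some (t, g) then Some (t, (g, x t + (Num.sqrt g)^-1 * w)) else None.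

Definition precision (a : action) : R := if a is Some (_, g) then g else 0.

Definition history (x : T -> R) (Omega : Type) (act : nat -> Omega -> action)
    (W : nat -> Omega -> R) (j : nat) (w : Omega) : j.-tuple datum :=
  [tuple measure_at x (act i w) (W i w) | i < j].

(* A probability space carrying a run of the policy K when the support is S.
   The joint law of the data is determined by K, mu and S, hence so are the
   probabilities and expectations below, whatever the space chosen. *)
Record run (K : policy) (mu : R) (S : {set T}) := Run {
  run_display : measure_display;
  run_space : measurableType run_display;
  run_prob : probability run_space R;
  run_act : nat -> {mfun run_space >-> action};
  run_noise : nat -> {mfun run_space >-> measurableTypeR R};
  run_precision_gt0 : forall j w t g, run_act j w = Some (t, g) -> 0 < g;
  run_stopped : forall j w, run_act j w = None -> run_act j.+1 w = None;
  (* the noise variables are i.i.d. standard normal *)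
  run_noise_iid : forall (N : nat) (C : 'I_N -> set (measurableTypeR R)),
    (forall j, measurable (C j)) ->
    run_prob [set w | forall j : 'I_N, C j (run_noise j w)] =
    (\prod_(j < N) normal_prob 0 1 (C j))%E;
  (* the j-th one is independent of the past data and of the j-th action *)
  run_noise_indep : forall (j : nat) (B : set (j.-tuple datum * action))
      (C : set (measurableTypeR R)), measurable B -> measurable C ->
    run_prob [set w |
      B (history (signal mu S) run_act run_noise j w, run_act j w) /\
      C (run_noise j w)] =
    (run_prob [set w |
       B (history (signal mu S) run_act run_noise j w, run_act j w)] *
     normal_prob 0 1 C)%E;
  (* K j is the conditional law of the j-th action given the past data *)
  run_act_law : forall (j : nat) (B : set (j.-tuple datum)) (C : set action),
      measurable B -> measurable C ->
    run_prob [set w |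
      B (history (signal mu S) run_act run_noise j w) /\ C (run_act j w)] =
    (\int[run_prob]_(w in [set w |
         B (history (signal mu S) run_act run_noise j w)])
       K j (history (signal mu S) run_act run_noise j w) C)%E
}.

Definition run_data (K : policy) (mu : R) (S : {set T}) (X : run K mu S)
    (w : run_space X) : nat -> datum :=
  fun j => measure_at (signal mu S) (run_act X j w) (run_noise X j w).

(* [\E_S (\sum_j Gamma_j)]; steps after stopping contribute 0. *)
Definition expected_budget (K : policy) (mu : R) (S : {set T})
    (X : run K mu S) : \bar R :=
  (\int[run_prob X]_w \sum_(0 <= j <oo) (precision (run_act X j w))%:E)%E.

(* Preimages under the estimator lie in the product sigma-algebra on the
   sequences of data. *)
Definition measurable_estimator (est : (nat -> datum) -> {set T}) : Prop :=
  forall A : {set T},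
    <<s \bigcup_j preimage_set_system setT (fun x : nat -> datum => x j)
          measurable >> (est @^-1` [set A]).

Definition error_prob (K : policy) (mu : R) (S : {set T}) (X : run K mu S)
    (est : (nat -> datum) -> {set T}) : \bar R :=
  run_prob X [set w | est (run_data w) <> S].

Definition expected_symdiff (K : policy) (mu : R) (S : {set T})
    (X : run K mu S) (est : (nat -> datum) -> {set T}) : \bar R :=
  ('E_(run_prob X)[fun w =>
     #|(est (run_data w) :\: S) :|: (S :\: est (run_data w))|%:R])%E.

End sensing.

Definition submatrices (n1 n2 s : nat) : {set {set 'I_n1 * 'I_n2}} :=
  [set S | [exists S1 : {set 'I_n1}, exists S2 : {set 'I_n2},
     (S == finset.setX S1 S2) && (#|S1| * #|S2| == s)%N]]%SET.

Definition submatrices0 (n1 n2 s : nat) : {set {set 'I_n1 * 'I_n2}} :=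
  (finset.set0 |: submatrices n1 n2 s)%SET.

(* Main.v *)
Require Import Defs.
From HB Require Import structures.
From mathcomp Require Import all_boot all_order all_algebra.
From mathcomp Require Import all_classical all_reals all_analysis.
From mathcomp Require Import measurable_realfun.
From mathcomp Require Import ring lra zify.

Set Implicit Arguments.
Unset Strict Implicit.
Unset Printing Implicit Defensive.

Import Order.TTheory GRing.Theory Num.Theory.
Import numFieldNormedType.Exports.

Local Open Scope classical_set_scope.
Local Open Scope ring_scope.

(** Under the empty support the expected precision spent on the blocks of the
    partition adds up to at most m, so some block S receives at most m s / n.
    Along the data, the log-likelihood ratio of S against the empty support has
    mean at most (mu^2 / 2) (m s / n) in absolute value. The inequality
    1 + x <= exp x, applied to x = a 1_A + (log-likelihood ratio), then gives

      a P_0(A) <= (e^a - 1) P_S(A) + (mu^2 / 2) (m s / n)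

    for every event A and every a >= 0; it plays the role of a bound on the
    relative entropy of P_0 with respect to P_S, with no entropy to define.
    It is first proved for A depending on finitely many data, where the two
    laws have an explicit density, and passes to the generated sigma-algebra
    since it is preserved by monotone limits of events.

    For (i) take A = {est = 0}, with a a large constant. For (ii) take for A
    the event that est misses at least half of S: by Markov's inequality
    P_S(A) and 1 - P_0(A) are both at most 2 e / s, e being the maximal
    expected error. The factor 1 / s in both is what allows a = log s + O(1):
    then a (1 - P_0(A)) and e^a P_S(A) stay bounded. *)

(** * Integrals determined by their values on indicators *)

Section integral_functional.
Local Open Scope ereal_scope.
Context d (T : measurableType d) (R : realType).
Variable nu : {measure set T -> \bar R}.
Variable Psi : (T -> \bar R) -> \bar R.
Hypothesis Psi_indic : forall A, measurable A -> Psi (EFin \o \1_A) = nu A.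
Hypothesis PsiZ : forall (c : R) (f : T -> \bar R),
  (0 <= c)%R -> measurable_fun setT f ->
  (forall x, 0 <= f x) -> Psi (fun x => c%:E * f x) = c%:E * Psi f.
Hypothesis PsiD : forall f g : T -> \bar R,
  measurable_fun setT f -> measurable_fun setT g ->
  (forall x, 0 <= f x) -> (forall x, 0 <= g x) ->
  Psi (fun x => f x + g x) = Psi f + Psi g.
Hypothesis Psi_lim : forall g : (T -> \bar R)^nat,
  (forall n, measurable_fun setT (g n)) -> (forall n x, 0 <= g n x) ->
  (forall x, {homo g ^~ x : n m / (n <= m)%N >-> n <= m}) ->
  Psi (fun x => limn (g ^~ x)) = limn (fun n => Psi (g n)).

Import HBNNSimple.

(** The two sides agree on indicators, hence on simple functions by linearity, hence on their
    increasing limits. Applied below to integrals against a density and to iterated integrals. *)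
Lemma functional_integral (f : T -> \bar R) :
  measurable_fun setT f -> (forall x, 0 <= f x) ->
  Psi f = \int[nu]_x f x.
Proof.
move=> mf f0.
pose f_ := nnsfun_approx measurableT mf.
have fE : f = fun x => limn (fun n => (f_ n x)%:E).
  apply/funext => x; apply/esym/cvg_lim => //; exact: cvg_nnsfun_approx.
have mf_ n : measurable_fun setT (EFin \o f_ n) by exact/measurable_EFinP.
have f_0 n x : 0 <= (f_ n x)%:E by rewrite lee_fin.
have f_nd x : {homo (fun n => (f_ n x)%:E) : n m / (n <= m)%N >-> n <= m}.
  by move=> a b ab; rewrite lee_fin; exact/lefP/nd_nnsfun_approx.
rewrite fE (@Psi_lim (fun n => EFin \o f_ n))// monotone_convergence//.
congr (limn _); apply/funext => n.
have Psi0 : Psi (cst 0) = 0.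
  have := @PsiZ 0%R (cst 0) (lexx _) (measurable_cst _) (fun=> lexx _).
  rewrite mul0e => P0; rewrite -[RHS]P0; congr Psi.
  by apply/funext => x/=; rewrite mule0.
have Psi_sum (s : seq R) (A : R -> set T) : (forall r, measurable (A r)) ->
    (forall r x, 0 <= (r * \1_(A r) x)%:E) ->
    Psi (fun x => \sum_(r <- s) (r * \1_(A r) x)%:E) =
    \sum_(r <- s) \int[nu]_x (r * \1_(A r) x)%:E.
  move=> mA A0; elim: s => [|r s ih].
    by rewrite big_nil -Psi0; congr Psi; apply/funext => x; rewrite big_nil.
  rewrite big_cons -ih.
  under eq_fun do rewrite big_cons.
  rewrite PsiD//; last 3 first.
    exact/measurable_EFinP/measurable_funM.
    by apply: emeasurable_sum => i; exact/measurable_EFinP/measurable_funM.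
    by move=> x; apply: sume_ge0.
  congr (_ + _).
  have [r0|r0] := leP 0%R r.
    under eq_fun do rewrite EFinM.
    rewrite PsiZ ?Psi_indic//; last by exact/measurable_EFinP/measurable_indic.
    rewrite ge0_integralZl//; last by exact/measurable_EFinP/measurable_indic.
    by rewrite integral_indic// setIT.
  (* Homogeneity is assumed for nonnegative factors only; a negative [r] with a nonnegative term
     forces an empty level set. *)
  have A1 x : \1_(A r) x = 0%R :> R.
    have := A0 r x; rewrite lee_fin indicE.
    by case: (x \in A r) => //; rewrite mulr1 leNgt r0.
  have -> : (fun x => (r * \1_(A r) x)%:E) = cst 0.
    by apply/funext => x; rewrite A1 mulr0.
  by rewrite integral0.
pose vals := finmap.enum_fset (fset_set (range (f_ n))).
have fimE x : (f_ n x)%:E = \sum_(r <- vals)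
    (r * \1_(f_ n @^-1` [set r]) x)%:E.
  by rewrite fimfunE fsbig_finite//= sumEFin.
have ge0 r x : 0 <= (r * \1_(f_ n @^-1` [set r]) x)%:E.
  exact: nnfun_muleindic_ge0.
under eq_integral do rewrite fimE.
rewrite (_ : EFin \o f_ n = fun x => \sum_(r <- vals)
    (r * \1_(f_ n @^-1` [set r]) x)%:E); last exact/funext.
rewrite Psi_sum// ge0_integral_sum// => r.
exact/measurable_EFinP/measurable_funM.
Qed.

End integral_functional.

(** * Gaussian measure and product laws *)

Section gaussian.
Local Open Scope ereal_scope.
Context (R : realType).
Notation leb := (@lebesgue_measure R).
Notation gauss := (@normal_prob R 0 1).

Lemma integral_normal_prob (m s : R) (f : measurableTypeR R -> \bar R) :
  measurable_fun setT f -> (forall x, 0 <= f x) ->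
  \int[normal_prob m s]_x f x = \int[leb]_x (f x * (normal_pdf m s x)%:E).
Proof.
move=> mf f0; apply/esym.
have mpdf : measurable_fun setT
    (fun x : measurableTypeR R => (normal_pdf m s x)%:E).
  by apply/measurable_EFinP; exact: measurable_normal_pdf.
have pdf0 x : 0 <= (normal_pdf m s x)%:E by rewrite lee_fin normal_pdf_ge0.
apply: (functional_integral
  (Psi := fun f => \int[leb]_x (f x * (normal_pdf m s x)%:E))) => //.
- move=> A mA; rewrite /normal_prob [RHS]integral_mkcond.
  apply: eq_integral => x _; rewrite /= indicE patchE.
  by case: ifPn => xA; rewrite ?mul1e ?mul0e.
- move=> c g c0 mg g0; rewrite -ge0_integralZl//.
  + by apply: eq_integral => x _; rewrite muleA.
  + exact: emeasurable_funM.
  + by move=> x _; rewrite mule_ge0.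
- move=> g h mg mh g0 h0; rewrite -ge0_integralD//.
  + by apply: eq_integral => x _; rewrite ge0_muleDl.
  + by move=> x _; rewrite mule_ge0.
  + exact: emeasurable_funM.
  + by move=> x _; rewrite mule_ge0.
  + exact: emeasurable_funM.
- move=> g mg g0 nd; rewrite -monotone_convergence//.
  + apply: eq_integral => x _; rewrite limeMr//.
    by apply: ereal_nondecreasing_is_cvgn => a b; exact: nd.
  + by move=> n; exact: emeasurable_funM.
  + by move=> n x _; rewrite mule_ge0.
  + by move=> x _ a b ab; rewrite lee_wpmul2r// nd.
Qed.

(** Translation preserves the length of half-open intervals, and these determine Lebesgue
    measure. *)
Lemma lebesgue_measureD (c : R) (A : set R) : measurable A ->
  pushforward leb
    (fun x : measurableTypeR R => (x + c)%R : measurableTypeR R) A = leb A.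
Proof.
move=> mA; apply/esym/lebesgue_measure_unique => //=.
  exact: measurable_funD.
move=> _ _ [[a b] _ <-].
rewrite /pushforward (_ : _ @^-1` _ = `](a - c)%R, (b - c)%R]%classic).
  rewrite !lebesgue_measure_itv/= !lte_fin ltrD2r.
  by case: ifPn => // _; rewrite -!EFinD; congr EFin; ring.
apply/seteqP; split => x/=; rewrite !in_itv/= => /andP[];
  by rewrite ?ltrBlDr ?lerBrDr => -> ->.
Qed.

Lemma ge0_integral_translation (c : R) (f : measurableTypeR R -> \bar R) :
  measurable_fun setT f -> (forall x, 0 <= f x) ->
  \int[leb]_x f (x + c)%R = \int[leb]_x f x.
Proof.
move=> mf f0; pose phi (x : measurableTypeR R) : measurableTypeR R := (x + c)%R.
have mphi : measurable_fun setT phi by exact: measurable_funD.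
rewrite -[LHS](@ge0_integral_pushforward _ _ _ _ R phi mphi leb setT f)//.
by apply: eq_measure_integral => A mA _; exact: lebesgue_measureD.
Qed.

(** Cameron-Martin formula in dimension one: the exponential is the density of N(c, 1) with respect
    to N(0, 1). After a translation of the Lebesgue integral, it remains to complete a square. *)
Lemma gaussian_shift (c : R) (f : measurableTypeR R -> \bar R) :
  measurable_fun setT f -> (forall x, 0 <= f x) ->
  \int[gauss]_x f (x + c)%R =
  \int[gauss]_x ((expR (c * x - c ^+ 2 / 2))%:E * f x).
Proof.
move=> mf f0.
have mexp : measurable_fun setT
    (fun x : measurableTypeR R => (expR (c * x - c ^+ 2 / 2))%:E).
  apply/measurable_EFinP; apply: measurableT_comp => //.
  by apply: measurable_funB => //; exact: measurable_funM.
rewrite integral_normal_prob//; last first.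
  by apply: measurableT_comp => //; exact: measurable_funD.
pose h x := (expR (c * x - c ^+ 2 / 2))%:E * f x * (normal_pdf 0 1 x)%:E.
have mh : measurable_fun setT h.
  apply: emeasurable_funM; first exact: emeasurable_funM.
  by apply/measurable_EFinP; exact: measurable_normal_pdf.
have h0 x : 0 <= h x by rewrite !mule_ge0// lee_fin ?expR_ge0 ?normal_pdf_ge0.
transitivity (\int[leb]_x h x); last first.
  rewrite integral_normal_prob//; first exact: emeasurable_funM.
  by move=> x; rewrite mule_ge0// lee_fin expR_ge0.
rewrite -(ge0_integral_translation c mh h0).
apply: eq_integral => x _; rewrite /h.
rewrite [X in _ = X * _]muleC -muleA -EFinM; congr (_ * EFin _).
rewrite !normal_pdfE ?oner_neq0// mulrCA; congr (_ * _)%R.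
by rewrite /normal_fun -expRD; congr expR; field.
Qed.

Lemma integral_gauss_exp (c : R) :
  \int[gauss]_x (expR (c * x - c ^+ 2 / 2))%:E = 1.
Proof.
have := @gaussian_shift c (cst 1) (measurable_cst _) (fun=> lee01).
under [in RHS]eq_integral do rewrite mule1.
move=> <-.
by rewrite integral_cst// mul1e; exact: probability_setT.
Qed.

End gaussian.

Section gaussian_moments.
Local Open Scope ereal_scope.
Context (R : realType).
Notation leb := (@lebesgue_measure R).
Notation gauss := (@normal_prob R 0 1).

(** The standard density is even. Used to match the positive and negative parts of the noise. *)
Lemma integral_gauss_opp (f : measurableTypeR R -> \bar R) :
  measurable_fun setT f -> (forall x, 0 <= f x) ->
  \int[gauss]_x f (- x)%R = \int[gauss]_x f x.
Proof.
move=> mf f0; pose phi (x : measurableTypeR R) : measurableTypeR R := (- x)%R.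
have mphi : measurable_fun setT phi by exact: oppr_measurable.
have mpdf : measurable_fun setT
    (fun x : measurableTypeR R => (normal_pdf 0 1 x)%:E).
  by apply/measurable_EFinP; exact: measurable_normal_pdf.
pose h x := f x * (normal_pdf 0 1 x)%:E.
have mh : measurable_fun setT h by exact: emeasurable_funM.
have h0 x : 0 <= h x by rewrite mule_ge0// lee_fin normal_pdf_ge0.
rewrite !integral_normal_prob//; last exact: measurableT_comp.
transitivity (\int[leb]_x (h \o phi) x).
  apply: eq_integral => x _; congr (_ * EFin _).
  by rewrite !normal_pdfE ?oner_neq0// /normal_fun !subr0 sqrrN.
rewrite -[LHS](@ge0_integral_pushforward _ _ _ _ R phi mphi leb setT h)//.
by apply: eq_measure_integral => A mA _; exact: lebesgue_measureN.
Qed.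

(** The positive part of x is below exp x, a multiple of the density integrated in
    [integral_gauss_exp]. *)
Lemma integral_gauss_pos_lty :
  \int[gauss]_x (Num.max x 0%R)%:E < +oo.
Proof.
have mexp : measurable_fun setT
    (fun x : measurableTypeR R => (expR (1 * x - 1 ^+ 2 / 2))%:E).
  apply/measurable_EFinP; apply: measurableT_comp => //.
  by apply: measurable_funB => //; exact: measurable_funM.
apply: (@le_lt_trans _ _ (\int[gauss]_x
    ((expR (1 / 2))%:E * (expR (1 * x - 1 ^+ 2 / 2))%:E))); last first.
  by rewrite ge0_integralZl// ?integral_gauss_exp ?mule1 ?ltry// => x _;
    rewrite lee_fin expR_ge0.
apply: ge0_le_integral => //.
- by move=> x _; rewrite lee_fin le_max lexx orbT.
- by apply/measurable_EFinP; exact: measurable_maxr.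
- exact: emeasurable_funM.
- move=> x _; rewrite -EFinM -expRD lee_fin ge_max expR_ge0 andbT.
  have := expR_ge1Dx x; rewrite (_ : _ + (_ - _) = x)%R; last by field.
  by apply: le_trans; rewrite lerDr.
Qed.

End gaussian_moments.

(** * Disintegration along a probability kernel *)

Section semidirect.
Local Open Scope ereal_scope.
Context d d' (X : measurableType d) (Y : measurableType d') (R : realType).
Variables (mu : {finite_measure set X -> \bar R}) (k : R.-pker X ~> Y).

(** The joint measure with first marginal [mu] and conditional law [k]. *)
Let m (A : set (X * Y)) : \bar R := \int[mu]_x k x (xsection A x).

Let mk A : measurable A -> measurable_fun setT (fun x => k x (xsection A x)).
Proof.
move=> mA; apply: measurable_fun_xsection_finite_kernel; exact: mem_set.
Qed.

Let m0 : m set0 = 0.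
Proof.
by rewrite /m; apply: integral0_eq => x _; rewrite xsection0 measure0.
Qed.

Let m_ge0 A : 0 <= m A.
Proof. exact: integral_ge0. Qed.

Let m_sigma_additive : semi_sigma_additive m.
Proof.
move=> F mF tF mUF; rewrite /m.
rewrite [X in _ --> X](_ : _ = \sum_(n <oo) m (F n)); last first.
  rewrite /m -integral_nneseries//; last by move=> n; exact: mk.
  apply: eq_integral => x _; rewrite xsection_bigcup measure_semi_bigcup//.
  - by move=> i; exact: measurable_xsection.
  - exact: trivIset_xsection.
  - by rewrite -xsection_bigcup; exact: measurable_xsection.
by apply: is_cvg_nneseries => n _ _; exact: m_ge0.
Qed.

HB.instance Definition _ := isMeasure.Build _ _ _ m m0 m_ge0 m_sigma_additive.

(** Rectangles are stable under intersection and generate the product sigma-algebra, so [nu]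
    coincides with [m]; [functional_integral] then extends the formula from indicators. *)
Lemma integral_semidirect (nu : {finite_measure set (X * Y)%type -> \bar R}) :
  (forall B C, measurable B -> measurable C ->
    nu (B `*` C) = \int[mu]_(x in B) k x C) ->
  forall f : X * Y -> \bar R, measurable_fun setT f -> (forall z, 0 <= f z) ->
  \int[nu]_z f z = \int[mu]_x \int[k x]_y f (x, y).
Proof.
move=> nuE f mf f0; apply/esym.
have mint (g : X * Y -> \bar R) : measurable_fun setT g ->
    (forall z, 0 <= g z) -> measurable_fun setT (fun x => \int[k x]_y g (x, y)).
  by move=> mg g0; exact: measurable_kfcomp.
have mpair (g : X * Y -> \bar R) : measurable_fun setT g ->
    forall x, measurable_fun setT (fun y => g (x, y)).
  by move=> mg x; exact: measurableT_comp.
apply: (functional_integral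
  (Psi := fun f : X * Y -> \bar R => \int[mu]_x \int[k x]_y f (x, y))) => //.
- move=> A mA; transitivity (m A).
    apply: eq_integral => x _; rewrite -(setIT (xsection A x)).
    rewrite -integral_indic//; last exact: measurable_xsection.
    by apply: eq_integral => y _ /=; rewrite !indicE mem_xsection.
  apply/esym; apply: (measure_unique
    [set D | exists2 B, measurable B & exists2 C, measurable C & B `*` C = D]
    (fun=> setT)) => //=.
  + exact: measurable_prod_measurableType.
  + move=> _ _ [B mB [C mC <-]] [B' mB' [C' mC' <-]].
    exists (B `&` B'); first exact: measurableI.
    by exists (C `&` C'); [exact: measurableI|rewrite setXI].
  + by move=> _; exists setT => //; exists setT => //; rewrite setXTT.
  + by rewrite bigcup_const.
  + move=> _ [B mB [C mC <-]].
    transitivity (\int[mu]_(x in B) k x C); first exact: nuE.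
    rewrite /= /m [LHS]integral_mkcond.
    apply: eq_integral => x _; rewrite patchE; case: ifPn => xB.
      by rewrite in_xsectionX.
    by rewrite notin_xsectionX// measure0.
  + by move=> _; rewrite ltey_eq fin_num_measure.
- move=> c g c0 mg g0; rewrite -ge0_integralZl//; last 2 first.
  + exact: mint.
  + by move=> x _; exact: integral_ge0.
  apply: eq_integral => x _; rewrite ge0_integralZl//; exact: mpair.
- move=> g h mg mh g0 h0; rewrite -ge0_integralD//.
  + by apply: eq_integral => x _; rewrite ge0_integralD//; exact: mpair.
  + by move=> x _; exact: integral_ge0.
  + exact: mint.
  + by move=> x _; exact: integral_ge0.
  + exact: mint.
- move=> g mg g0 nd; rewrite -monotone_convergence//.
  + apply: eq_integral => x _; rewrite -monotone_convergence//.
      by move=> n; exact: mpair.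
  + by move=> n; exact: (mint _ (mg n) (g0 n)).
  + by move=> n x _; exact: integral_ge0.
  + move=> x _ a b ab; apply: ge0_le_integral => //; try exact: mpair.
    by move=> y _; exact: nd.
Qed.

End semidirect.

Section product_law.
Local Open Scope ereal_scope.
Context d d' (X : measurableType d) (Y : measurableType d') (R : realType).

Lemma integral_product_law (mu : probability X R) (rho : probability Y R)
    (nu : probability (X * Y)%type R) :
  (forall B C, measurable B -> measurable C -> nu (B `*` C) = mu B * rho C) ->
  forall f : X * Y -> \bar R, measurable_fun setT f -> (forall z, 0 <= f z) ->
  \int[nu]_z f z = \int[mu]_x \int[rho]_y f (x, y).
Proof.
move=> nuE f mf f0; rewrite -fubini_tonelli1//.
apply: eq_measure_integral => A mA _; apply/esym.
exact: (product_measure_unique nuE).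
Qed.

End product_law.

(** * Runs of a policy *)

Section measurable_stop_or.
Context (T : finType) d (D : measurableType d).

Lemma measurable_stop_or_some (t : T) :
  measurable_fun setT (fun x : D => Some (t, x) : stop_or T D).
Proof. by move=> _ A mA; rewrite setTI; exact: mA. Qed.

Lemma measurable_fun_stop_or d' (F : measurableType d') (f : stop_or T D -> F) :
  (forall t, measurable_fun setT (fun x => f (Some (t, x)))) ->
  measurable_fun setT f.
Proof.
move=> mf _ A mA; rewrite setTI -[measurable _]/(stop_or_measurable _) => t.
by have := mf t measurableT A mA; rewrite setTI.
Qed.

(** The tag of the first component cuts the product into finitely many measurable slices, each a
    copy of [D * E] or of [E], on which measurability is tested separately. *)
Lemma measurable_fun_stop_or_pair d' (E : measurableType d')
    d'' (F : measurableType d'') (f : stop_or T D * E -> F) :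
  (forall t, measurable_fun setT (fun z : D * E => f (Some (t, z.1), z.2))) ->
  measurable_fun setT (fun y => f (None, y)) ->
  measurable_fun setT f.
Proof.
move=> mfS mfN _ A mA; rewrite setTI.
(* The default at [None] is harmless: [payload] is only read on slices tagged [Some t]. *)
pose payload (a : stop_or T D) : D := if a is Some (_, x) then x else point.
have mpayload : measurable_fun setT payload.
  by apply: measurable_fun_stop_or => t; exact: measurable_id.
pose tag (t : option T) : set (stop_or T D * E) :=
  [set z | omap fst z.1 = t].
have mtag t : measurable (tag t).
  rewrite (_ : tag t = fst @^-1` [set a : stop_or T D | omap fst a = t])//.
  rewrite -[X in measurable X]setTI; apply: measurable_fst => //.
  rewrite -[measurable _]/(stop_or_measurable _) => t'.
  have [->|tt'] := eqVneq t (Some t').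
    by rewrite (_ : [set _ | _] = setT)//; apply/seteqP; split.
  rewrite (_ : [set _ | _] = set0)//; apply/seteqP; split => //= x [tt].
  by rewrite -tt eqxx in tt'.
rewrite (_ : f @^-1` A =
    (tag None `&` snd @^-1` [set y | A (f (None, y))]) `|`
    \bigcup_(t in [set: T]) (tag (Some t) `&`
      (fun z => (payload z.1, z.2)) @^-1`
        [set z : D * E | A (f (Some (t, z.1), z.2))])).
  apply: measurableU.
    apply: measurableI => //; rewrite -[X in measurable X]setTI.
    apply: measurable_snd => //.
    by have := mfN measurableT A mA; rewrite setTI.
  apply: fin_bigcup_measurable => [|t _]; first exact: finite_finset.
  apply: measurableI => //; rewrite -[X in measurable X]setTI.
  have mp : measurable_fun setT
      (fun z : stop_or T D * E => (payload z.1, z.2)).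
    by apply/measurable_fun_pair => //; exact: measurableT_comp.
  apply: mp => //.
  by have := mfS t measurableT A mA; rewrite setTI.
apply/seteqP; split=> [[[[t x]|] y] /= Afy|[[[t x]|] y]/=].
- by right; exists t.
- by left.
- by case=> [[]//|[t' _ [[<-]]]].
- by case=> [[]//|[t' _ []//]].
Qed.

End measurable_stop_or.

Section snoc.
Context d (D : measurableType d).

(** [unlift ord_max i] fails exactly at the last index, which receives [x]. *)
Definition snoc n (h : n.-tuple D) (x : D) : n.+1.-tuple D :=
  [tuple oapp (tnth h) x (unlift ord_max i) | i < n.+1].

Lemma measurable_snoc n :
  measurable_fun setT (fun z : n.-tuple D * D => snoc z.1 z.2).
Proof.
apply/measurable_fun_tnthP => i.
rewrite (_ : _ \o _ = fun z => oapp (tnth z.1) z.2 (unlift ord_max i));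
  last first.
  by apply/funext => z; rewrite /= /snoc tnth_mktuple.
case: (unlift ord_max i) => [k|] /=; last exact: measurable_snd.
by apply: (measurableT_comp (measurable_tnth k)).
Qed.

End snoc.

Section history.
Context (R : realType) (T : finType).
Notation datum := (datum R T).
Notation action := (action R T).

Lemma measurable_measure_at (x : T -> R) :
  measurable_fun setT
    (fun z : action * measurableTypeR R => measure_at x z.1 z.2 : datum).
Proof.
apply: measurable_fun_stop_or_pair => [t|]; last exact: measurable_cst.
apply: (measurableT_comp (measurable_stop_or_some _)).
apply/measurable_fun_pair => //=.
apply: measurable_funD => //; apply: measurable_funM => //.
have minv : measurable_fun setT (fun g : measurableTypeR R => (Num.sqrt g)^-1).
  (* For g > 0 this is exp of minus half of ln g; elsewhere it is 0, since the square root of a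
     nonpositive number and the inverse of 0 are both 0. *)
  rewrite (_ : (fun _ => _) =
      (fun g => if 0 < g then expR (- (2^-1 * ln g)) else 0)).
    apply: measurable_fun_ifT => //; first exact: measurable_fun_ltr.
    apply: measurableT_comp => //; apply: measurableT_comp => //.
    by apply: measurable_funM => //; exact: measurable_ln.
  apply/funext => g; case: ifPn => [g0|]; last first.
    by rewrite -leNgt => g0; rewrite ler0_sqrtr// invr0.
  by rewrite -powR12_sqrt ?ltW// /powR gt_eqF// expRN.
exact: (measurableT_comp minv).
Qed.

Lemma history_snoc (x : T -> R) Omega (act : nat -> Omega -> action)
    (W : nat -> Omega -> R) j w :
  history x act W j.+1 w =
  snoc (history x act W j w) (measure_at x (act j w) (W j w)).
Proof.
apply: eq_from_tnth => i; rewrite !tnth_mktuple.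
case: unliftP => [k ->|->] //=; rewrite tnth_mktuple.
by rewrite /bump leqNgt ltn_ord.
Qed.

Lemma measurable_history (x : T -> R) d (Omega : measurableType d)
    (act : nat -> {mfun Omega >-> action})
    (W : nat -> {mfun Omega >-> measurableTypeR R}) j :
  measurable_fun setT
    (history x (fun i => act i) (fun i => W i) j : Omega -> j.-tuple datum).
Proof.
apply/measurable_fun_tnthP => i.
rewrite (_ : _ \o _ = fun w => measure_at x (act i w) (W i w)); last first.
  by apply/funext => w; rewrite /= tnth_mktuple.
pose f w := (act i w, W i w).
apply: (measurableT_comp (@measurable_measure_at x) (g := f)).
exact/measurable_fun_pair.
Qed.

End history.

Section run_integrals.
Local Open Scope ereal_scope.
Context (R : realType) (T : finType) (K : policy R T) (mu : R) (S : {set T})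
  (X : run K mu S).
Notation P := (run_prob X).
Notation gauss := (@normal_prob R 0 1).

Definition run_history j (w : run_space X) : j.-tuple (datum R T) :=
  history (signal mu S) (run_act X) (run_noise X) j w.

Lemma measurable_run_history j : measurable_fun setT (@run_history j).
Proof. exact: measurable_history. Qed.

HB.instance Definition _ j :=
  isMeasurableFun.Build _ _ _ _ (@run_history j) (@measurable_run_history j).

Definition run_past j (w : run_space X) : j.-tuple (datum R T) * action R T :=
  (run_history j w, run_act X j w).

Lemma measurable_run_past j : measurable_fun setT (@run_past j).
Proof. exact/measurable_fun_pair. Qed.

HB.instance Definition _ j :=
  isMeasurableFun.Build _ _ _ _ (@run_past j) (@measurable_run_past j).

Definition run_step j (w : run_space X) :
    j.-tuple (datum R T) * action R T * measurableTypeR R :=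
  (run_past j w, run_noise X j w).

Lemma measurable_run_step j : measurable_fun setT (@run_step j).
Proof. exact/measurable_fun_pair. Qed.

HB.instance Definition _ j :=
  isMeasurableFun.Build _ _ _ _ (@run_step j) (@measurable_run_step j).

(** The noise is independent of the past data and the current action together, so the law of
    [run_step] is a product and Tonelli applies. *)
Lemma integral_run_noise j
    (F : j.-tuple (datum R T) * action R T * measurableTypeR R -> \bar R) :
  measurable_fun setT F -> (forall z, 0 <= F z) ->
  \int[P]_w F (run_step j w) = \int[P]_w \int[gauss]_z F (run_past j w, z).
Proof.
move=> mF F0.
rewrite -(ge0_integral_distribution (run_step j))//.
rewrite (@integral_product_law _ _ _ _ _ (distribution P (run_past j)) gauss)//.
  rewrite ge0_integral_distribution//.
    exact: (measurable_fun_fubini_tonelli_F (m2 := gauss)) mF F0.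
  by move=> h; exact: integral_ge0.
move=> B C mB mC; exact: (@run_noise_indep _ _ _ _ _ X j B C mB mC).
Qed.

(** On rectangles, [run_act_law] is the disintegration that [integral_semidirect] asks for. *)
Lemma integral_run_act j (F : j.-tuple (datum R T) * action R T -> \bar R) :
  measurable_fun setT F -> (forall z, 0 <= F z) ->
  \int[P]_w F (run_past j w) =
  \int[P]_w \int[K j (run_history j w)]_a F (run_history j w, a).
Proof.
move=> mF F0.
rewrite -(ge0_integral_distribution (run_past j))//.
rewrite (@integral_semidirect _ _ _ _ _
  (distribution P (run_history j)) (K j))//.
  rewrite ge0_integral_distribution//.
    exact: measurable_kfcomp.
  by move=> h; exact: integral_ge0.
move=> B C mB mC.
rewrite ge0_integral_pushforward//; last first.
  by apply: measurable_funTS; exact: measurable_kernel.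
by rewrite /distribution /pushforward -run_act_law.
Qed.

End run_integrals.

Arguments run_history {R T K mu S} X j w.
Arguments run_past {R T K mu S} X j w.
Arguments run_step {R T K mu S} X j w.

(** * Change of measure *)

Section likelihood.
Context (R : realType) (T : finType) (mu : R) (S : {set T}).
Notation datum := (datum R T).
Notation action := (action R T).
Notation gauss := (@normal_prob R 0 1).
Notation null := (signal mu (@finset.set0 T)).

(* The density of N(mu, 1/g) with respect to N(0, 1/g), evaluated at y. *)
Definition likelihood_ratio (x : datum) : R :=
  if x is Some (t, (g, y)) then
    if t \in S then expR (g * mu * y - g * mu ^+ 2 / 2) else 1
  else 1.

Lemma likelihood_ratio_ge0 x : 0 <= likelihood_ratio x.
Proof. by case: x => [[t [g y]]|]//=; case: ifP => // _; exact: expR_ge0. Qed.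

Lemma measurable_likelihood_ratio :
  measurable_fun setT (likelihood_ratio : datum -> measurableTypeR R).
Proof.
apply: measurable_fun_stop_or => t /=; case: (t \in S); last first.
  by rewrite (_ : (fun _ => _) = cst 1)//; apply/funext => -[].
rewrite (_ : (fun _ => _) =
    (fun z => expR (z.1 * mu * z.2 - z.1 * mu ^+ 2 / 2))).
  apply: measurableT_comp => //; apply: measurable_funB.
    by apply: measurable_funM => //; exact: measurable_funM.
  by apply: measurable_funM => //; exact: measurable_funM.
by apply/funext => -[].
Qed.

Definition positive_precision (a : action) : bool :=
  if a is Some (_, g) then 0 < g else true.

Lemma measurable_positive_precision : measurable_fun setT positive_precision.
Proof.
apply: measurable_fun_stop_or => t /=.
exact: measurable_fun_ltr.
Qed.

(** Adding [mu] to the mean at precision g amounts to translating the standard noise by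
    [mu * sqrt g]; [gaussian_shift] turns the translation into a density. *)
Lemma likelihood_ratio_shift (a : action) (F : datum -> \bar R) :
  positive_precision a -> measurable_fun setT F -> (forall x, 0 <= F x)%E ->
  (\int[gauss]_z F (measure_at (signal mu S) a z) =
   \int[gauss]_z ((likelihood_ratio (measure_at null a z))%:E *
                  F (measure_at null a z)))%E.
Proof.
case: a => [[t g]|_ _ _]; last by apply: eq_integral => z _; rewrite /= mul1e.
move=> /= g0 mF F0; rewrite /signal inE.
case: ifPn => tS; last by apply: eq_integral => z _; rewrite mul1e.
have sg0 : Num.sqrt g != 0 by rewrite gt_eqF// sqrtr_gt0.
have sgg : g = Num.sqrt g ^+ 2 by rewrite sqr_sqrtr// ltW.
pose f (z : measurableTypeR R) : \bar R :=
  F (Some (t, (g, (0 + (Num.sqrt g)^-1 * z)%R))).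
transitivity (\int[gauss]_z f (z + mu * Num.sqrt g)%R)%E.
  apply: eq_integral => z _; congr (F (Some (t, (g, _)))).
  by field.
rewrite gaussian_shift; last 2 first.
  have mz : measurable_fun setT (fun z : measurableTypeR R =>
      (g, 0 + (Num.sqrt g)^-1 * z) : measurableTypeR R * measurableTypeR R).
    apply/measurable_fun_pair => //.
    by apply: measurable_funD => //; exact: measurable_funM.
  have ms := measurableT_comp (@measurable_stop_or_some T _ _ t) mz.
  exact: (measurableT_comp mF ms).
  by move=> z; exact: F0.
apply: eq_integral => z _; congr (EFin (expR _) * _)%E.
by rewrite [in RHS]sgg sqrtr_sqr ger0_norm ?sqrtr_ge0//; field.
Qed.

Definition likelihood n (h : n.-tuple datum) : R :=
  \prod_(i < n) likelihood_ratio (tnth h i).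

Lemma likelihood_ge0 n (h : n.-tuple datum) : 0 <= likelihood h.
Proof. by apply: prodr_ge0 => i _; exact: likelihood_ratio_ge0. Qed.

Lemma measurable_likelihood n :
  measurable_fun setT (@likelihood n : _ -> measurableTypeR R).
Proof.
apply: measurable_prod => i _.
apply: (measurableT_comp measurable_likelihood_ratio).
exact: measurable_tnth.
Qed.

Lemma likelihood_snoc n (h : n.-tuple datum) x :
  likelihood (snoc h x) = likelihood h * likelihood_ratio x.
Proof.
rewrite /likelihood big_ord_recr/=; congr (_ * likelihood_ratio _).
  apply: eq_bigr => i _; congr likelihood_ratio; rewrite tnth_mktuple.
  case: unliftP => /= [k /(congr1 val)|/(congr1 val)/eqP]/=.
    by rewrite /bump leqNgt ltn_ord add0n => /val_inj ->.
  by rewrite ltn_eqF.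
rewrite tnth_mktuple; case: unliftP => // k /eqP.
by rewrite (negPf (neq_lift _ _)).
Qed.

End likelihood.

Lemma integral_probability_cst d (Y : measurableType d) (R : realType)
    (P : probability Y R) (c : \bar R) : (\int[P]_y c = c)%E.
Proof.
rewrite integral_cst// -[RHS]mule1; congr (_ * _)%E; exact: probability_setT.
Qed.

Section change_of_measure.
Local Open Scope ereal_scope.
Context (R : realType) (T : finType) (K : policy R T) (mu : R).
Notation gauss := (@normal_prob R 0 1).

Lemma measurable_snoc_measure_at (x : T -> R) j
    (F : j.+1.-tuple (datum R T) -> \bar R) :
  measurable_fun setT F ->
  measurable_fun setT
    (fun z : j.-tuple (datum R T) * action R T * measurableTypeR R =>
      F (snoc z.1.1 (measure_at x z.1.2 z.2))).
Proof.
move=> mF.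
have ma : measurable_fun setT (fun z : j.-tuple (datum R T) * action R T *
    measurableTypeR R => (z.1.2, z.2)).
  by apply/measurable_fun_pair => //; exact: measurableT_comp.
have mh : measurable_fun setT (fun z : j.-tuple (datum R T) * action R T *
    measurableTypeR R => (z.1.1, measure_at x z.1.2 z.2)).
  apply/measurable_fun_pair => /=; first exact: measurableT_comp.
  exact: (measurableT_comp (@measurable_measure_at R T x) ma).
have ms := measurableT_comp (@measurable_snoc _ _ j) mh.
exact: (measurableT_comp mF ms).
Qed.

Lemma integral_run_history_snoc (S : {set T}) (X : run K mu S) j
    (F : j.+1.-tuple (datum R T) -> \bar R) :
  measurable_fun setT F -> (forall h, 0 <= F h) ->
  \int[run_prob X]_w F (run_history X j.+1 w) =
  \int[run_prob X]_w \int[gauss]_z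
    F (snoc (run_history X j w) (measure_at (signal mu S) (run_act X j w) z)).
Proof.
move=> mF F0.
under eq_integral do rewrite /run_history history_snoc.
have := measurable_snoc_measure_at (signal mu S) mF.
by move=> /(integral_run_noise X); apply => z; exact: F0.
Qed.

Lemma positive_precision_run (S : {set T}) (X : run K mu S) j w :
  positive_precision (run_act X j w).
Proof.
have := @run_precision_gt0 _ _ _ _ _ X j w.
by case: (run_act X j w) => [[t g]|] //=; apply.
Qed.

Variable S : {set T}.
Notation null := (@finset.set0 T).

(** Induction on the number of data. Both supports share the kernels, so each step changes the law
    only through the Gaussian noise, and the density gains one factor [likelihood_ratio]. *)
Theorem change_of_measure (X0 : run K mu null) (XS : run K mu S) n
    (F : n.-tuple (datum R T) -> \bar R) :
  measurable_fun setT F -> (forall h, 0 <= F h) ->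
  \int[run_prob XS]_w F (run_history XS n w) =
  \int[run_prob X0]_w ((likelihood mu S (run_history X0 n w))%:E *
                       F (run_history X0 n w)).
Proof.
elim: n F => [|n IH] F mF F0.
  pose h0 : 0.-tuple (datum R T) := [tuple].
  transitivity (F h0).
    under eq_integral do rewrite (tuple0 (run_history _ _ _)).
    by rewrite integral_probability_cst.
  under eq_integral do
    rewrite (tuple0 (run_history _ _ _)) /likelihood big_ord0 mul1e.
  by rewrite integral_probability_cst.
(* The kernel may charge actions of nonpositive precision, at which the Gaussian
   shift fails; runs never take them, so J is set to 0 there. *)
pose J (x : T -> R) (F : n.+1.-tuple (datum R T) -> \bar R)
    (z : n.-tuple (datum R T) * action R T) : \bar R :=
  if positive_precision z.2 then
    \int[gauss]_y F (snoc z.1 (measure_at x z.2 y)) else 0.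
have mJ x F' : measurable_fun setT F' -> (forall h, 0 <= F' h) ->
    measurable_fun setT (J x F').
  move=> mF' F'0; apply: measurable_fun_ifT.
  - exact: (measurableT_comp (@measurable_positive_precision R T)).
  - have := measurable_snoc_measure_at x mF'.
    move=> /(measurable_fun_fubini_tonelli_F (m2 := gauss)); apply.
    by move=> z; exact: F'0.
  - exact: measurable_cst.
have J0 x F' : (forall h, 0 <= F' h) -> forall z, 0 <= J x F' z.
  move=> F'0 z; rewrite /J; case: ifP => // _; exact: integral_ge0.
have step (S' : {set T}) (X : run K mu S') F' : measurable_fun setT F' ->
    (forall h, 0 <= F' h) ->
    \int[run_prob X]_w F' (run_history X n.+1 w) =
    \int[run_prob X]_w J (signal mu S') F' (run_past X n w).
  move=> mF' F'0; rewrite integral_run_history_snoc//.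
  by apply: eq_integral => w _; rewrite /J positive_precision_run.
(* Integrating out the last action and its noise leaves a function of n data, ready for the
   induction hypothesis. *)
pose G F' h := \int[K n h]_a J (signal mu S) F' (h, a).
have mG F' : measurable_fun setT F' -> (forall h, 0 <= F' h) ->
    measurable_fun setT (G F').
  move=> mF' F'0; apply: measurable_kfcomp; [exact: mJ|exact: J0].
have G0 F' : (forall h, 0 <= F' h) -> forall h, 0 <= G F' h.
  by move=> F'0 h; apply: integral_ge0 => a _; exact: J0.
have mL k : measurable_fun setT
    (fun h : k.-tuple (datum R T) => (likelihood mu S h)%:E).
  by apply/measurable_EFinP; exact: measurable_likelihood.
have L0 k (h : k.-tuple (datum R T)) : 0 <= (likelihood mu S h)%:E.
  by rewrite lee_fin likelihood_ge0.
rewrite step// integral_run_act; [|exact: mJ|exact: J0].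
rewrite (IH (G F)); [|exact: mG|exact: G0].
rewrite (step _ X0 (fun h => (likelihood mu S h)%:E * F h)); last 2 first.
  by apply: emeasurable_funM => //; exact: mL.
  by move=> h; rewrite mule_ge0.
transitivity (\int[run_prob X0]_w \int[K n (run_history X0 n w)]_a
    ((likelihood mu S (run_history X0 n w))%:E *
      J (signal mu S) F (run_history X0 n w, a))).
  apply: eq_integral => w _; rewrite ge0_integralZl//.
  - exact: measurableT_comp (mJ _ _ mF F0) _.
  - by move=> a _; exact: J0.
(* The same kernel folds back into the run with empty support; only the last noise still follows the
   signal of [S]. *)
rewrite -(integral_run_act X0 (F := fun z => (likelihood mu S z.1)%:E *
    J (signal mu S) F z)); last 2 first.
  apply: emeasurable_funM; last exact: mJ.
  exact: (measurableT_comp (mL n)).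
  by move=> z; rewrite mule_ge0// J0.
apply: eq_integral => w _; rewrite /J positive_precision_run /=.
set h := run_history X0 n w; set a := run_act X0 n w.
have mhy : measurable_fun setT (fun y : datum R T => (h, y)).
  exact/measurable_fun_pair.
have mFh : measurable_fun setT (fun y : datum R T => F (snoc h y)).
  have ms := measurableT_comp (@measurable_snoc _ _ n) mhy.
  exact: (measurableT_comp mF ms).
have maz : measurable_fun setT (fun z : measurableTypeR R => (a, z)).
  exact/measurable_fun_pair.
have mz := measurableT_comp (@measurable_measure_at R T (signal mu null)) maz.
(* With the past and the action frozen, the last noise is shifted. *)
have := @likelihood_ratio_shift R T mu S a (fun y => F (snoc h y))
  (positive_precision_run n w) mFh (fun y => F0 _).
move=> ->.
rewrite -ge0_integralZl//; last 2 first.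
- apply: emeasurable_funM; last exact: (measurableT_comp mFh mz).
  apply/measurable_EFinP.
  exact: (measurableT_comp (@measurable_likelihood_ratio R T mu S) mz).
- by move=> z _; rewrite mule_ge0// lee_fin likelihood_ratio_ge0.
by apply: eq_integral => z _; rewrite likelihood_snoc EFinM muleA.
Qed.

End change_of_measure.

(** * Information bound *)

Section information.
Local Open Scope ereal_scope.
Context (R : realType) (T : finType) (K : policy R T) (mu : R) (S : {set T}).
Notation gauss := (@normal_prob R 0 1).
Notation null := (@finset.set0 T).

Definition precision_on (a : action R T) : R :=
  if a is Some (t, g) then if t \in S then g else 0%R else 0%R.

Lemma measurable_precision_on :
  measurable_fun setT (precision_on : _ -> measurableTypeR R).
Proof.
apply: measurable_fun_stop_or => t /=.
by case: (t \in S).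
Qed.

(** The shift of the standard noise that separates [S] from the empty support at this action. *)
Definition drift (a : action R T) : R := (mu * Num.sqrt (precision_on a))%R.

Lemma measurable_drift : measurable_fun setT (drift : _ -> measurableTypeR R).
Proof.
apply: measurable_funM => //.
have ms : measurable_fun setT
    (fun g : measurableTypeR R => Num.sqrt g : measurableTypeR R).
  by apply: continuous_measurable_fun; exact: sqrt_continuous.
exact: (measurableT_comp ms measurable_precision_on).
Qed.

(** Without signal the observation is the noise over the square root of the precision, so
    [g * mu * y] becomes the drift times the noise. *)
Lemma likelihood_ratio_null a z : positive_precision a ->
  likelihood_ratio mu S (measure_at (signal mu null) a z) =
  expR (drift a * z - drift a ^+ 2 / 2).
Proof.
rewrite /drift; case: a => [[t g]|] /=; last first.
  by rewrite sqrtr0 mulr0 mul0r expr0n/= mul0r subrr expR0.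
rewrite /signal inE; case: ifP => _ g0; last first.
  by rewrite sqrtr0 mulr0 mul0r expr0n/= mul0r subrr expR0.
have sg0 : Num.sqrt g != 0%R by rewrite gt_eqF// sqrtr_gt0.
have sgg : g = (Num.sqrt g ^+ 2)%R by rewrite sqr_sqrtr// ltW.
congr expR.
by rewrite [in LHS]sgg sqrtr_sqr ger0_norm ?sqrtr_ge0//; field.
Qed.

Lemma precision_on_ge0 a : positive_precision a -> (0 <= precision_on a)%R.
Proof. by case: a => [[t g]|]//= /ltW; case: ifP. Qed.

Lemma drift_sqr a : positive_precision a ->
  (drift a ^+ 2 = mu ^+ 2 * precision_on a)%R.
Proof. by move=> /precision_on_ge0 h; rewrite exprMn sqr_sqrtr. Qed.

Hypothesis mu_ge0 : (0 <= mu)%R.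

Lemma drift_ge0 a : (0 <= drift a)%R.
Proof. by rewrite mulr_ge0// sqrtr_ge0. Qed.

Variable X : run K mu null.
Notation P := (run_prob X).

Lemma measurable_run_drift j :
  measurable_fun setT (fun w => drift (run_act X j w)).
Proof. exact: (measurableT_comp measurable_drift). Qed.

(** The drift is a function of the current action, of which the noise is independent. *)
Lemma integral_drift_noise (f : measurableTypeR R -> R) j :
  measurable_fun setT f -> (forall z, 0 <= f z)%R ->
  \int[P]_w (drift (run_act X j w) * f (run_noise X j w))%:E =
  (\int[P]_w (drift (run_act X j w))%:E) * (\int[gauss]_z (f z)%:E).
Proof.
move=> mf f0.
have md : measurable_fun setT (fun z : j.-tuple (datum R T) * action R T *
    measurableTypeR R => drift z.1.2).
  by apply: (measurableT_comp measurable_drift); exact: measurableT_comp.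
have mF : measurable_fun setT (fun z : j.-tuple (datum R T) * action R T *
    measurableTypeR R => (drift z.1.2 * f z.2)%:E).
  apply/measurable_EFinP; apply: measurable_funM => //.
  exact: measurableT_comp.
rewrite (integral_run_noise X mF); last first.
  by move=> z; rewrite lee_fin mulr_ge0// drift_ge0.
rewrite -ge0_integralZr//.
- apply: eq_integral => w _ /=.
  under eq_integral do rewrite EFinM.
  rewrite ge0_integralZl//.
  + exact/measurable_EFinP.
  + by move=> z _; rewrite lee_fin.
  + by rewrite lee_fin drift_ge0.
- by apply/measurable_EFinP; exact: measurable_run_drift.
- by move=> w _; rewrite lee_fin drift_ge0.
- by apply: integral_ge0 => z _; rewrite lee_fin.
Qed.

Lemma precision_on_run_ge0 j w : (0 <= precision_on (run_act X j w))%R.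
Proof. exact/precision_on_ge0/positive_precision_run. Qed.

Lemma measurable_run_precision_on j :
  measurable_fun setT (fun w => precision_on (run_act X j w)).
Proof. exact: (measurableT_comp measurable_precision_on). Qed.

Section moments.
Variable j : nat.
Hypothesis prec_lty : \int[P]_w (precision_on (run_act X j w))%:E < +oo.

Lemma integrable_precision_on :
  P.-integrable setT (fun w => (precision_on (run_act X j w))%:E).
Proof.
apply/integrableP; split.
  by apply/measurable_EFinP; exact: measurable_run_precision_on.
by under eq_integral do rewrite gee0_abs ?lee_fin ?precision_on_run_ge0//.
Qed.

Lemma integral_drift_lty : \int[P]_w (drift (run_act X j w))%:E < +oo.
Proof.
have mp : measurable_fun setT
    (fun w => (mu ^+ 2)%:E * (precision_on (run_act X j w))%:E).
  apply: measurable_funeM.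
  by apply/measurable_EFinP; exact: measurable_run_precision_on.
have p0 w : 0 <= (mu ^+ 2)%:E * (precision_on (run_act X j w))%:E.
  by rewrite -EFinM lee_fin mulr_ge0 ?sqr_ge0 ?precision_on_run_ge0.
apply: (@le_lt_trans _ _ (\int[P]_w
    (1 + (mu ^+ 2)%:E * (precision_on (run_act X j w))%:E))).
  apply: ge0_le_integral => //.
  - by move=> w _; rewrite lee_fin drift_ge0.
  - by apply/measurable_EFinP; exact: measurable_run_drift.
  - exact: emeasurable_funD.
  - move=> w _; rewrite -EFinM -EFinD lee_fin.
    rewrite -drift_sqr ?positive_precision_run//.
    (* The square gives x <= x ^ 2 + 1 / 4 for the drift x, hence x <= 1 + x ^ 2. *)
    have := sqr_ge0 (drift (run_act X j w) - 2^-1); nra.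
rewrite ge0_integralD// integral_probability_cst ge0_integralZl//; last 3 first.
- by apply/measurable_EFinP; exact: measurable_run_precision_on.
- by move=> w _; rewrite lee_fin precision_on_run_ge0.
- by rewrite lee_fin sqr_ge0.
by rewrite lte_add_pinfty ?ltry// lte_mul_pinfty// lee_fin sqr_ge0.
Qed.

(** The positive and negative parts of the noise have the same finite mean by symmetry, so their
    contributions, given by [integral_drift_noise], cancel. *)
Lemma drift_noise_integral0 :
  P.-integrable setT (fun w => (drift (run_act X j w) * run_noise X j w)%:E) /\
  \int[P]_w (drift (run_act X j w) * run_noise X j w)%:E = 0.
Proof.
pose pos (z : measurableTypeR R) : R := Num.max z 0%R.
pose neg (z : measurableTypeR R) : R := Num.max (- z)%R 0%R.
have mpos : measurable_fun setT pos by exact: measurable_maxr.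
have mneg : measurable_fun setT neg.
  by apply: measurable_maxr => //; exact: oppr_measurable.
have pos0 z : (0 <= pos z)%R by rewrite /pos le_max lexx orbT.
have neg0 z : (0 <= neg z)%R by rewrite /neg le_max lexx orbT.
have gneg : \int[gauss]_z (neg z)%:E = \int[gauss]_z (pos z)%:E.
  rewrite -(integral_gauss_opp (f := fun z => (pos z)%:E))//.
    by exact/measurable_EFinP.
have int (f : measurableTypeR R -> R) : measurable_fun setT f ->
    (forall z, 0 <= f z)%R -> \int[gauss]_z (f z)%:E < +oo ->
    P.-integrable setT
      (fun w => (drift (run_act X j w) * f (run_noise X j w))%:E).
  move=> mf f0 foo; apply/integrableP; split.
    apply/measurable_EFinP; apply: measurable_funM.
      exact: measurable_run_drift.
    exact: measurableT_comp.
  under eq_integral do rewrite gee0_abs ?lee_fin ?mulr_ge0 ?drift_ge0//.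
  rewrite integral_drift_noise// lte_mul_pinfty ?integral_drift_lty//.
    by apply: integral_ge0 => w _; rewrite lee_fin drift_ge0.
  rewrite ge0_fin_numE ?integral_drift_lty//.
  by apply: integral_ge0 => w _; rewrite lee_fin drift_ge0.
have poslty : \int[gauss]_z (pos z)%:E < +oo by exact: integral_gauss_pos_lty.
have ipos := int _ mpos pos0 poslty.
have ineg : P.-integrable setT
    (fun w => (drift (run_act X j w) * neg (run_noise X j w))%:E).
  by apply: int => //; rewrite gneg.
have dE w : ((drift (run_act X j w) * run_noise X j w)%:E =
    (drift (run_act X j w) * pos (run_noise X j w))%:E -
    (drift (run_act X j w) * neg (run_noise X j w))%:E).
  rewrite -EFinB -mulrBr; congr (EFin (_ * _)%R); rewrite /pos /neg.
  by have [z0|z0] := leP (run_noise X j w : R) 0%R;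
    [rewrite max_l ?oppr_ge0// sub0r opprK|
     rewrite max_r ?subr0// oppr_le0 ltW].
rewrite (_ : (fun w => _) = (fun w =>
    (drift (run_act X j w) * pos (run_noise X j w))%:E -
    (drift (run_act X j w) * neg (run_noise X j w))%:E)); last exact/funext.
split; first exact: integrableB.
rewrite integralB_EFin// !integral_drift_noise// gneg subee//.
rewrite fin_numM// ge0_fin_numE ?integral_drift_lty//.
- by apply: integral_ge0 => w _; rewrite lee_fin drift_ge0.
- by apply: integral_ge0 => z _; rewrite lee_fin.
Qed.

End moments.

(** Written through the noise rather than the data, the form that holds along runs with empty
    support. *)
Definition log_likelihood n w : R :=
  \sum_(j < n) (drift (run_act X j w) * run_noise X j w -
                drift (run_act X j w) ^+ 2 / 2).

Lemma likelihood_run n w :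
  likelihood mu S (run_history X n w) = expR (log_likelihood n w).
Proof.
rewrite /likelihood /log_likelihood expR_sum; apply: eq_bigr => i _.
by rewrite tnth_mktuple likelihood_ratio_null// positive_precision_run.
Qed.

Variable D : R.
Hypothesis precision_le :
  \int[P]_w \sum_(0 <= j <oo) (precision_on (run_act X j w))%:E <= D%:E.

Let p j : R := fine (\int[P]_w (precision_on (run_act X j w))%:E).

Let mprec j : measurable_fun setT (fun w => (precision_on (run_act X j w))%:E).
Proof. by apply/measurable_EFinP; exact: measurable_run_precision_on. Qed.

Let prec0 j w : 0 <= (precision_on (run_act X j w))%:E.
Proof. by rewrite lee_fin precision_on_run_ge0. Qed.

Let sum_prec_le n :
  \sum_(j < n) \int[P]_w (precision_on (run_act X j w))%:E <= D%:E.
Proof.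
apply: le_trans precision_le.
rewrite -ge0_integral_sum//.
apply: ge0_le_integral => //.
- by move=> w _; exact: sume_ge0.
- exact: emeasurable_sum.
- by apply: ge0_emeasurable_sum => // j w _.
- move=> w _.
  rewrite -(big_mkord xpredT (fun j => (precision_on (run_act X j w))%:E)).
  exact: nneseries_lim_ge.
Qed.

Let prec_lty j : \int[P]_w (precision_on (run_act X j w))%:E < +oo.
Proof.
apply: le_lt_trans (ltry D); apply: le_trans (sum_prec_le j.+1).
rewrite big_ord_recr/= leeDr//; apply: sume_ge0 => i _.
exact: integral_ge0.
Qed.

Let prec_fine j : \int[P]_w (precision_on (run_act X j w))%:E = (p j)%:E.
Proof.
by rewrite fineK// ge0_fin_numE ?prec_lty//; exact: integral_ge0.
Qed.

(** The products of drift and noise are centred, so only the terms [drift ^+ 2 / 2] contribute;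
    [drift_sqr] turns them into precision spent on [S]. *)
Lemma integral_log_likelihood n :
  P.-integrable setT (fun w => (log_likelihood n w)%:E) /\
  \int[P]_w (log_likelihood n w)%:E = (- (mu ^+ 2 / 2 * \sum_(j < n) p j))%:E.
Proof.
elim: n => [|n [iL IH]].
  rewrite (_ : (fun w => _) = cst 0); last first.
    by apply/funext => w; rewrite /log_likelihood big_ord0.
  by rewrite big_ord0 mulr0 oppr0 integral0; split => //; exact: integrable0.
have [idn dn0] := drift_noise_integral0 (prec_lty n).
pose q w := (mu ^+ 2 / 2 * precision_on (run_act X n w))%R.
have iq : P.-integrable setT (EFin \o q).
  have ip := integrable_precision_on (prec_lty n).
  exact: (integrableZl measurableT (mu ^+ 2 / 2) ip).
have qE : \int[P]_w (q w)%:E = (mu ^+ 2 / 2 * p n)%:E.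
  under eq_integral do rewrite EFinM.
  by rewrite integralZl ?prec_fine//; exact: integrable_precision_on.
rewrite (_ : (fun w => _) = (fun w => (log_likelihood n w)%:E +
    (drift (run_act X n w) * run_noise X n w - q w)%:E)); last first.
  apply/funext => w; rewrite /log_likelihood big_ord_recr/= -EFinD.
  by rewrite /q drift_sqr ?positive_precision_run//; congr EFin; field.
have idq : P.-integrable setT
    (EFin \o (fun w => drift (run_act X n w) * run_noise X n w - q w)%R).
  exact: (integrableB measurableT idn iq).
split; first exact: integrableD.
rewrite integralD_EFin// IH; under [X in _ + X]eq_integral do rewrite /= EFinB.
rewrite integralB_EFin// dn0 qE sub0e big_ord_recr/=.
by congr EFin; ring.
Qed.

Theorem information_bound_finite (XS : run K mu S) (a : R) n
    (A : set (n.-tuple (datum R T))) : (0 <= a)%R -> measurable A ->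
  (a * fine (P (run_history X n @^-1` A)) <=
   (expR a - 1) * fine (run_prob XS (run_history XS n @^-1` A)) +
   mu ^+ 2 / 2 * D)%R.
Proof.
move=> a0 mA.
have mAX : measurable (run_history X n @^-1` A).
  by rewrite -[X in measurable X]setTI; exact: measurable_run_history.
have mAS : measurable (run_history XS n @^-1` A).
  by rewrite -[X in measurable X]setTI; exact: measurable_run_history.
have ea0 : (0 <= expR a - 1)%R by rewrite subr_ge0 -expR0 ler_expR.
(* Taking only two values, this exponential is affine in the indicator, so its mean under [S] is
   explicit. *)
pose F (h : n.-tuple (datum R T)) : \bar R := (expR (a * \1_A h))%:E.
have mF : measurable_fun setT F.
  apply/measurable_EFinP; apply: measurableT_comp => //.
  by apply: measurable_funM => //; exact: measurable_indic.
have F0 h : 0 <= F h by rewrite lee_fin expR_ge0.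
have FE h : F h = 1 + (expR a - 1)%:E * (\1_A h)%:E.
  rewrite /F -EFinM -EFinD; congr EFin; rewrite indicE.
  by case: (h \in A); rewrite ?mulr1 ?mulr0 ?expR0 ?addr0// addrC subrK.
have PSE : \int[run_prob XS]_w F (run_history XS n w) =
    (1 + (expR a - 1) * fine (run_prob XS (run_history XS n @^-1` A)))%:E.
  under eq_integral do rewrite FE.
  rewrite ge0_integralD//; last 2 first.
  - by move=> w _; rewrite -EFinM lee_fin mulr_ge0.
  - apply: measurable_funeM; apply/measurable_EFinP.
    exact: (measurable_indic mAS).
  rewrite integral_probability_cst ge0_integralZl//; last first.
  - apply/measurable_EFinP.
    exact: (measurable_indic mAS).
  rewrite [in RHS]EFinD [in RHS]EFinM fineK ?fin_num_measure//.
  congr (_ + _ * _).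
  by rewrite -(setIT (_ @^-1` A)) -integral_indic.
(* By the change of measure, the mean of exp [g] under the empty support is the mean of [F] under
   [S]; this also gives its integrability. *)
pose g w := (a * \1_A (run_history X n w) + log_likelihood n w)%R.
have expgE : \int[P]_w (expR (g w))%:E =
    (1 + (expR a - 1) * fine (run_prob XS (run_history XS n @^-1` A)))%:E.
  rewrite -PSE (change_of_measure X XS mF F0); apply: eq_integral => w _.
  by rewrite likelihood_run -EFinM -expRD addrC.
have [iL LE] := integral_log_likelihood n.
have i1A : P.-integrable setT (fun w => (\1_A (run_history X n w))%:E).
  exact: (integrable_indic P mAX).
have iA : P.-integrable setT
    (EFin \o (fun w => a * \1_A (run_history X n w))%R).
  exact: (integrableZl measurableT a i1A).
have ig : P.-integrable setT (EFin \o g).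
  exact: (integrableD measurableT iA iL).
have gE : \int[P]_w (g w)%:E = (a * fine (P (run_history X n @^-1` A)) -
    mu ^+ 2 / 2 * \sum_(j < n) p j)%:E.
  under eq_integral do rewrite EFinD.
  rewrite integralD_EFin// LE [RHS]EFinD; congr (_ + _).
  rewrite /=; under eq_integral do rewrite EFinM.
  rewrite integralZl// EFinM fineK ?fin_num_measure//; congr (_ * _).
  by rewrite -(setIT (_ @^-1` A)) -integral_indic.
have i1 : P.-integrable setT (cst 1 : _ -> \bar R).
  exact: finite_measure_integrable_cst.
have iexp : P.-integrable setT (fun w => (expR (g w))%:E).
  apply/integrableP; split.
    apply/measurable_EFinP; apply: measurableT_comp => //.
    by apply/measurable_EFinP; exact: measurable_int ig.
  under eq_integral do rewrite gee0_abs ?lee_fin ?expR_ge0//.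
  by rewrite expgE ltry.
(* The inequality 1 + x <= exp x is integrated at x = [g w]. The constants 1 cancel, and the
   expected precision over n steps is then bounded by [D]. *)
have : \int[P]_w (1 + (g w)%:E) <= \int[P]_w (expR (g w))%:E.
  apply: le_integral => //; first exact: integrableD.
  by move=> w _; rewrite -EFinD lee_fin expR_ge1Dx.
rewrite expgE integralD// integral_probability_cst gE -EFinD lee_fin lerD2l.
move=> h; rewrite -lerBlDr; apply: le_trans h; rewrite lerD2l lerN2.
apply: ler_wpM2l; first by rewrite divr_ge0 ?sqr_ge0.
rewrite -lee_fin; apply: le_trans (sum_prec_le n).
by rewrite -sumEFin; under [leRHS]eq_bigr do rewrite prec_fine.
Qed.

End information.

(** * Cylinder events and passage to infinite sequences of data *)

Section cylinders.
Context d (D : measurableType d).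

Definition truncation n (x : nat -> D) : n.-tuple D := [tuple x i | i < n].

Definition cylinder : set (set (nat -> D)) :=
  [set A | exists n, exists2 B : set (n.-tuple D),
    measurable B & A = truncation n @^-1` B].

(** Brings two cylinders to a common length, where set operations are done on finite tuples. *)
Lemma cylinder_widen n m (B : set (n.-tuple D)) : (n <= m)%N -> measurable B ->
  exists2 C : set (m.-tuple D), measurable C &
    truncation n @^-1` B = truncation m @^-1` C.
Proof.
move=> nm mB.
pose r (h : m.-tuple D) : n.-tuple D := [tuple tnth h (widen_ord nm i) | i < n].
have mr : measurable_fun setT r.
  apply/measurable_fun_tnthP => i.
  rewrite (_ : _ \o _ = fun h : m.-tuple D => tnth h (widen_ord nm i)).
    exact: measurable_tnth.
  by apply/funext => h; rewrite /= tnth_mktuple.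
exists (r @^-1` B); first by rewrite -[X in measurable X]setTI; exact: mr.
rewrite -comp_preimage (_ : r \o _ = truncation n)//; apply/funext => x.
by apply: eq_from_tnth => i; rewrite !tnth_mktuple.
Qed.

Lemma cylinder2 A A' : cylinder A -> cylinder A' ->
  exists n, exists B B' : set (n.-tuple D), [/\ measurable B, measurable B',
    A = truncation n @^-1` B & A' = truncation n @^-1` B'].
Proof.
move=> [n [B mB ->]] [n' [B' mB' ->]].
have [C mC ->] := cylinder_widen (leq_maxl n n') mB.
have [C' mC' ->] := cylinder_widen (leq_maxr n n') mB'.
by exists (maxn n n'), C, C'.
Qed.

Lemma setring_cylinder : setring cylinder.
Proof.
split.
- by exists 0%N, set0 => //; rewrite preimage_set0.
- move=> A A' /cylinder2 h /h[n [B [B' [mB mB' -> ->]]]].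
  by exists n, (B `|` B'); [exact: measurableU|rewrite preimage_setU].
- move=> A A' /cylinder2 h /h[n [B [B' [mB mB' -> ->]]]].
  by exists n, (B `\` B'); [exact: measurableD|].
Qed.

(** The whole space is a cylinder, so the generated sigma-ring is closed under complement; it also
    contains the events on one coordinate. *)
Lemma sigma_algebra_cylinder :
  <<s \bigcup_j preimage_set_system setT (fun x : nat -> D => x j) measurable >>
  `<=` <<sr cylinder >>.
Proof.
have [sr0 srD srU] : sigma_ring <<sr cylinder >> by exact: smallest_sigma_ring.
apply: smallest_sub; first split => //.
  move=> A srA; apply: srD => //; apply: sub_g_sigma_ring.
  by exists 0%N, setT => //; rewrite preimage_setT.
move=> _ [j _ [B mB <-]]; apply: sub_g_sigma_ring.
(* Coordinate [j] is the last of the first [j.+1] data. *)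
exists j.+1, ((fun h : j.+1.-tuple D => tnth h ord_max) @^-1` B).
  by rewrite -[X in measurable X]setTI; exact: measurable_tnth.
rewrite setTI -comp_preimage (_ : _ \o _ = fun x => x j)//.
by apply/funext => x; rewrite /= tnth_mktuple.
Qed.

End cylinders.

Section information_bound.
Context (R : realType) (T : finType) (K : policy R T) (mu : R) (S : {set T}).
Notation null := (@finset.set0 T).

Theorem information_bound (X : run K mu null) (XS : run K mu S) (D a : R)
    (A : set (nat -> datum R T)) :
  0 <= mu ->
  (\int[run_prob X]_w \sum_(0 <= j <oo) (precision_on S (run_act X j w))%:E <=
    D%:E)%E ->
  0 <= a ->
  <<s \bigcup_j preimage_set_system setT (fun x : nat -> datum R T => x j)
        measurable >> A ->
  [/\ measurable (@run_data _ _ _ _ _ X @^-1` A),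
      measurable (@run_data _ _ _ _ _ XS @^-1` A) &
  a * fine (run_prob X (@run_data _ _ _ _ _ X @^-1` A)) <=
   (expR a - 1) * fine (run_prob XS (@run_data _ _ _ _ _ XS @^-1` A)) +
   mu ^+ 2 / 2 * D].
Proof.
move=> mu0 XD a0 /sigma_algebra_cylinder sA.
(* Measurability of both preimages is part of the class, since continuity of the two probabilities
   along monotone sequences relies on it. *)
pose Q := [set A : set (nat -> datum R T) |
  [/\ measurable (@run_data _ _ _ _ _ X @^-1` A),
      measurable (@run_data _ _ _ _ _ XS @^-1` A) &
  a * fine (run_prob X (@run_data _ _ _ _ _ X @^-1` A)) <=
   (expR a - 1) * fine (run_prob XS (@run_data _ _ _ _ _ XS @^-1` A)) +
   mu ^+ 2 / 2 * D]].
suff : <<sr cylinder (D := datum R T) >> `<=` Q by apply.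
(* Each side of the inequality is affine in one of the two probabilities, so the inequality survives
   limits. *)
have limQ (F : (set (nat -> datum R T))^nat) G : (forall n, Q (F n)) ->
    measurable (@run_data _ _ _ _ _ X @^-1` G) ->
    measurable (@run_data _ _ _ _ _ XS @^-1` G) ->
    (run_prob X (@run_data _ _ _ _ _ X @^-1` F n) @[n --> \oo] -->
      run_prob X (@run_data _ _ _ _ _ X @^-1` G)) ->
    (run_prob XS (@run_data _ _ _ _ _ XS @^-1` F n) @[n --> \oo] -->
      run_prob XS (@run_data _ _ _ _ _ XS @^-1` G)) ->
    Q G.
  move=> QF mG mG' cX cXS; split => //.
  have fc d (Y : measurableType d) (P : probability Y R) (E : (set Y)^nat) E' :
      measurable E' -> P (E n) @[n --> \oo] --> P E' ->
      fine (P (E n)) @[n --> \oo] --> fine (P E').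
    by move=> mE' c; apply: fine_cvg; rewrite fineK ?fin_num_measure.
  have l := cvgM (cvg_cst a) (fc _ _ (run_prob X) _ _ mG cX).
  have r := cvgD
    (cvgM (cvg_cst (expR a - 1)) (fc _ _ (run_prob XS) _ _ mG' cXS))
    (cvg_cst (mu ^+ 2 / 2 * D)).
  apply: (ler_cvg_to (l _ _) (r _ _ _ _)).
  by near=> n; have [] := QF n.
apply: monotone_setring_sub_g_sigma_ring; [split| |].
- move=> F ndF QF; apply: (limQ F) => //.
  + rewrite preimage_bigcup; apply: bigcup_measurable => n _.
    by have [] := QF n.
  + rewrite preimage_bigcup; apply: bigcup_measurable => n _.
    by have [] := QF n.
  + rewrite preimage_bigcup; apply: nondecreasing_cvg_mu.
    * by move=> n; have [] := QF n.
    * by apply: bigcup_measurable => n _; have [] := QF n.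
    * move=> n m nm; apply/subsetPset => w.
      exact: (subsetPset _ _ (ndF _ _ nm)).
  + rewrite preimage_bigcup; apply: nondecreasing_cvg_mu.
    * by move=> n; have [] := QF n.
    * by apply: bigcup_measurable => n _; have [] := QF n.
    * move=> n m nm; apply/subsetPset => w.
      exact: (subsetPset _ _ (ndF _ _ nm)).
- move=> F niF QF; apply: (limQ F) => //.
  + rewrite preimage_bigcap; apply: bigcap_measurable => // n _.
    by have [] := QF n.
  + rewrite preimage_bigcap; apply: bigcap_measurable => // n _.
    by have [] := QF n.
  + rewrite preimage_bigcap; apply: nonincreasing_cvg_mu.
    * by rewrite ltey_eq fin_num_measure//; have [] := QF 0%N.
    * by move=> n; have [] := QF n.
    * by apply: bigcap_measurable => // n _; have [] := QF n.
    * move=> n m nm; apply/subsetPset => w.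
      exact: (subsetPset _ _ (niF _ _ nm)).
  + rewrite preimage_bigcap; apply: nonincreasing_cvg_mu.
    * by rewrite ltey_eq fin_num_measure//; have [] := QF 0%N.
    * by move=> n; have [] := QF n.
    * by apply: bigcap_measurable => // n _; have [] := QF n.
    * move=> n m nm; apply/subsetPset => w.
      exact: (subsetPset _ _ (niF _ _ nm)).
- exact: setring_cylinder.
- move=> _ [n [B mB ->]]; split.
  + rewrite -[X in measurable X]setTI.
    exact: (@measurable_run_history _ _ _ _ _ X n).
  + rewrite -[X in measurable X]setTI.
    exact: (@measurable_run_history _ _ _ _ _ XS n).
  + exact: (information_bound_finite mu0 XD XS a0 mB).
Unshelve. all: end_near.
Qed.

End information_bound.

(** * Lower bounds on the signal strength *)

Section pigeonhole.
Local Open Scope ereal_scope.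
Context (R : realType) (T : finType) (K : policy R T) (mu : R)
  (X : run K mu (@finset.set0 T)).
Notation P := (run_prob X).

(** The measured coordinate lies in exactly one block, which alone counts its precision. *)
Lemma sum_precision_on (Q : {set {set T}}) (a : action R T) :
  finset.partition Q [set: T]%SET ->
  (\sum_(S in Q) precision_on S a = precision a)%R.
Proof.
move=> /and3P[/eqP coverQ trivQ _].
case: a => [[t g]|] /=; last by rewrite big1.
have tQ : t \in finset.cover Q by rewrite coverQ inE.
rewrite (bigD1 (finset.pblock Q t)) ?finset.pblock_mem//=.
rewrite finset.mem_pblock tQ big1 ?addr0// => S.
move=> /andP[SQ SQt]; case: ifPn => // tS.
by rewrite (finset.def_pblock trivQ SQ tS) eqxx in SQt.
Qed.

(** Averaging: the expected precisions on the [#|T| / s] blocks add up to the budget, so some block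
    receives at most the mean share. *)
Lemma exists_cheap_block (Q : {set {set T}}) (s : nat) (m : R) :
  finset.partition Q [set: T]%SET -> {in Q, forall S : {set T}, #|S| = s} ->
  (0 < #|T|)%N -> expected_budget X <= m%:E ->
  exists2 S, S \in Q &
    \int[P]_w \sum_(0 <= j <oo) (precision_on S (run_act X j w))%:E <=
    (m * s%:R / #|T|%:R)%:E.
Proof.
move=> partQ cardQ T0 budget.
pose I (S : {set T}) :=
  \int[P]_w \sum_(0 <= j <oo) (precision_on S (run_act X j w))%:E.
have prec0 (S : {set T}) j w : 0 <= (precision_on S (run_act X j w))%:E.
  by rewrite lee_fin precision_on_run_ge0.
have mprec (S : {set T}) j :
    measurable_fun setT (fun w => (precision_on S (run_act X j w))%:E).
  by apply/measurable_EFinP; exact: measurable_run_precision_on.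
have I0 S : 0 <= I S.
  by apply: integral_ge0 => w _; apply: nneseries_ge0 => j _ _.
have sumI : \sum_(S in Q) I S = expected_budget X.
  rewrite -big_enum /I /= -ge0_integral_sum//; last 2 first.
  - by move=> S; apply: ge0_emeasurable_sum => // j w _ _.
  - by move=> S w _; apply: nneseries_ge0 => j _ _.
  apply: eq_integral => w _; rewrite -nneseries_sum//.
  apply: eq_eseriesr => j _; rewrite big_enum/= sumEFin.
  by rewrite sum_precision_on.
have cardT : #|T| = (#|Q| * s)%N.
  by rewrite -cardsT; exact: card_uniform_partition.
have Ifin S : S \in Q -> I S \is a fin_num.
  move=> SQ; rewrite ge0_fin_numE//; apply: le_lt_trans (ltry m).
  apply: le_trans budget; rewrite -sumI (bigD1 S)//= leeDl//.
  exact: sume_ge0.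
have [//|noS] := pselect (exists2 S, S \in Q & I S <= (m * s%:R / #|T|%:R)%:E).
have ltI S : S \in Q -> (m * s%:R / #|T|%:R < fine (I S))%R.
  move=> SQ; rewrite -lte_fin fineK ?Ifin// ltNge; apply/negP => le.
  by apply: noS; exists S.
have Q0 : (0 < #|Q|)%N by move: T0; rewrite cardT muln_gt0 => /andP[].
have s0 : (0 < s)%N by move: T0; rewrite cardT muln_gt0 => /andP[].
(* If every block exceeded its share, summing over the nonempty partition would give m < m. *)
suff : (m < m)%R by rewrite ltxx.
have {1}-> : (m = \sum_(S in Q) (m * s%:R / #|T|%:R))%R.
  rewrite sumr_const cardT natrM -mulr_natr.
  by field; rewrite !pnatr_eq0 -!lt0n Q0 s0.
apply: (@lt_le_trans _ _ (\sum_(S in Q) fine (I S))%R).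
  apply: ltr_sum => //.
  have /card_gt0P[S SQ] := Q0.
  by apply/hasP; exists S => //; exact: mem_index_enum.
rewrite -lee_fin -sumEFin; move: budget; rewrite -sumI.
by under [X in _ -> X <= _]eq_bigr => S SQ do rewrite fineK ?Ifin//.
Qed.

End pigeonhole.

(** * Estimator events and Markov's inequality *)

Section estimators.
Context (R : realType) (T : finType) (K : policy R T) (mu : R).
Variable est : (nat -> datum R T) -> {set T}.
Hypothesis est_measurable : measurable_estimator est.

Lemma measurable_run_data (S : {set T}) (X : run K mu S)
    (A : set (nat -> datum R T)) :
  <<s \bigcup_j preimage_set_system setT (fun x : nat -> datum R T => x j)
        measurable >> A ->
  measurable (@run_data _ _ _ _ _ X @^-1` A).
Proof.
move=> sA.
suff : <<s \bigcup_j preimage_set_system setT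
    (fun x : nat -> datum R T => x j) measurable >> `<=`
    [set A | measurable (@run_data _ _ _ _ _ X @^-1` A)] by apply.
apply: smallest_sub; first split => /=.
- by rewrite preimage_set0.
- by move=> B mB; rewrite setTD preimage_setC; exact: measurableC.
- by move=> F mF; rewrite preimage_bigcup; exact: bigcup_measurable.
move=> _ [j _ [B mB <-]]; rewrite /= setTI.
have mn : measurable_fun setT (fun w => (run_act X j w, run_noise X j w)).
  exact/measurable_fun_pair.
have := measurableT_comp (@measurable_measure_at R T (signal mu S)) mn.
by move=> /(_ measurableT B mB); rewrite setTI.
Qed.

Lemma estimator_event (U : {set {set T}}) :
  <<s \bigcup_j preimage_set_system setT (fun x : nat -> datum R T => x j)
        measurable >> [set x | est x \in U].
Proof.
(* The finite union over [U] is indexed by the natural numbers through [pickle], to use closure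
   under countable unions. *)
pose F n : set (nat -> datum R T) :=
  if unpickle n is Some B then
    if B \in U then est @^-1` [set B] else set0
  else set0.
rewrite (_ : [set _ | _] = \bigcup_n F n).
  apply: sigma_algebra_bigcup => n; rewrite /F.
  case: unpickle => [B|]; last exact: sigma_algebra0.
  by case: ifP => _; [exact: est_measurable|exact: sigma_algebra0].
apply/seteqP; split=> [x /= xU|x [n _]].
  by exists (pickle (est x)) => //; rewrite /F pickleK xU.
by rewrite /F; case: unpickle => // B; case: ifPn => //= BU ->.
Qed.

Definition est_prob (S : {set T}) (X : run K mu S) (U : {set {set T}}) : R :=
  fine (run_prob X [set w | est (run_data w) \in U]).

Lemma measurable_est (S : {set T}) (X : run K mu S) (U : {set {set T}}) :
  measurable [set w : run_space X | est (run_data w) \in U].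
Proof. exact: measurable_run_data (estimator_event U). Qed.

Lemma est_prob_setC (S : {set T}) (X : run K mu S) (U : {set {set T}}) :
  est_prob X (~: U)%SET = 1 - est_prob X U.
Proof.
rewrite /est_prob (_ : [set w | _] = ~` [set w | est (run_data w) \in U]).
  rewrite probability_setC; last exact: measurable_est.
  by rewrite fineB// fin_num_measure//; exact: measurable_est.
by apply/seteqP; split => w /=; rewrite inE => /negP.
Qed.

Lemma error_probE (S : {set T}) (X : run K mu S) :
  error_prob X est = (1 - est_prob X [set S])%:E.
Proof.
rewrite -est_prob_setC /est_prob fineK; last first.
  by rewrite fin_num_measure//; exact: measurable_est.
congr (run_prob X _); apply/seteqP; split => w /=; rewrite !inE => /eqP //.
Qed.

(** Markov's inequality for the size of the symmetric difference, which is at least [c] on the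
    event. *)
Lemma est_prob_symdiff (S : {set T}) (X : run K mu S) (U : {set {set T}})
    (c e : R) : 0 <= c ->
  (forall B, B \in U -> c <= #|(B :\: S) :|: (S :\: B)|%:R) ->
  (expected_symdiff X est <= e%:E)%E -> c * est_prob X U <= e.
Proof.
move=> c0 cU; rewrite -lee_fin; apply: le_trans.
rewrite EFinM /est_prob fineK; last first.
  by rewrite fin_num_measure//; exact: measurable_est.
have -> : expected_symdiff X est = (\int[run_prob X]_w
    (#|(est (run_data w) :\: S) :|: (S :\: est (run_data w))|%:R)%:E)%E.
  by rewrite /expected_symdiff unlock.
rewrite -(setIT [set w : run_space X | est (run_data w) \in U]).
have mU := measurable_est X U.
rewrite -integral_indic// -ge0_integralZl//; last first.
  by apply/measurable_EFinP.
apply: ge0_le_integral => //.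
- by move=> w _; rewrite -EFinM lee_fin mulr_ge0.
- by apply: measurable_funeM; apply/measurable_EFinP.
- apply/measurable_EFinP => _ Y _; rewrite setTI.
  (* The loss depends on the data only through the estimate, so its preimages are estimator
     events. *)
  pose V : {set {set T}} :=
    [set B | `[< Y (#|(B :\: S) :|: (S :\: B)|%:R) >]]%SET.
  rewrite (_ : _ @^-1` _ = [set w | est (run_data w) \in V]).
    exact: measurable_est.
  by apply/seteqP; split => w /=; rewrite inE => /asboolP.
- move=> w _; rewrite -EFinM lee_fin indicE.
  case: (boolP (w \in _)) => [|_]; last by rewrite mulr0.
  by rewrite inE/= mulr1 => /cU.
Qed.

End estimators.

Section two_point_bounds.
Context (R : realType) (T : finType) (K : policy R T) (mu : R).
Variable est : (nat -> datum R T) -> {set T}.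
Hypothesis est_measurable : measurable_estimator est.
Hypothesis mu_ge0 : 0 <= mu.
Variables (S : {set T}) (X0 : run K mu (@finset.set0 T)) (XS : run K mu S).
Variable D : R.
Hypothesis cheap :
  (\int[run_prob X0]_w \sum_(0 <= j <oo) (precision_on S (run_act X0 j w))%:E <=
    D%:E)%E.

Lemma est_prob_information (U : {set {set T}}) (a : R) : 0 <= a ->
  a * est_prob est X0 U <= (expR a - 1) * est_prob est XS U + mu ^+ 2 / 2 * D.
Proof.
move=> a0.
have mU := estimator_event est_measurable U.
by have [] := information_bound XS mu_ge0 cheap a0 mU.
Qed.

(* Information bound on the event that the estimator returns the empty set. *)
Lemma exact_recovery_bound (a e : R) : 0 <= a -> S != finset.set0 ->
  (error_prob X0 est <= e%:E)%E -> (error_prob XS est <= e%:E)%E ->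
  a - e * (a + expR a) <= mu ^+ 2 / 2 * D.
Proof.
move=> a0 S0; rewrite !(error_probE est_measurable) !lee_fin => e0 eS.
have := est_prob_information [set finset.set0] a0.
(* As [S] is nonempty, answering the empty set is an error under [S]. *)
have h : est_prob est XS [set finset.set0] <= e.
  apply: le_trans eS; rewrite -est_prob_setC//; apply: fine_le.
  - by rewrite fin_num_measure//; exact: measurable_est.
  - by rewrite fin_num_measure//; exact: measurable_est.
  apply: le_measure; rewrite ?inE; try exact: measurable_est.
  by move=> w /=; rewrite !inE => /eqP ->; rewrite eq_sym.
have h0 : 0 <= est_prob est XS [set finset.set0] by exact: fine_ge0.
have ea : 1 <= expR a by rewrite -expR0 ler_expR.
(* The event has probability at least 1 - e under the empty support and at most e under [S], which
   costs a e and e exp a respectively. *)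
move: (est_prob _ _ _) (est_prob _ _ _) (expR a) e0 h h0 ea => p q E *.
nra.
Qed.

(* Information bound on the event U that the estimator misses half of S. *)
Lemma approximate_recovery_bound (a e : R) : 0 <= a -> S != finset.set0 ->
  (expected_symdiff X0 est <= e%:E)%E -> (expected_symdiff XS est <= e%:E)%E ->
  a - 2 * e / #|S|%:R * (a + expR a) <= mu ^+ 2 / 2 * D.
Proof.
move=> a0 S0 e0 eS.
have s0 : 0 < #|S|%:R :> R by rewrite ltr0n card_gt0.
pose U : {set {set T}} :=
    [set B : {set T} | (#|S| <= 2 * #|S :\: B|)%N]%SET.
have hS : est_prob est XS U <= 2 * e / #|S|%:R.
  have := est_prob_symdiff est_measurable (c := #|S|%:R / 2) (U := U) _ _ eS.
  move=> h; suff : #|S|%:R / 2 * est_prob est XS U <= e.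
    by rewrite ler_pdivlMr// => ?; nra.
  apply: h => [|B]; first by rewrite divr_ge0.
  rewrite inE => BU; rewrite ler_pdivrMr// -natrM ler_nat mulnC.
  apply: leq_trans BU _; rewrite leq_mul2l/=.
  exact: (subset_leq_card (finset.subsetUr _ _)).
have h0 : 1 - est_prob est X0 U <= 2 * e / #|S|%:R.
  rewrite -est_prob_setC//.
  have := est_prob_symdiff est_measurable
    (c := #|S|%:R / 2) (U := (~: U)%SET) _ _ e0.
  move=> h; suff : #|S|%:R / 2 * est_prob est X0 (~: U)%SET <= e.
    by rewrite ler_pdivlMr// => ?; nra.
  apply: h => [|B]; first by rewrite divr_ge0.
  rewrite !inE -ltnNge => BU; rewrite ler_pdivrMr// -natrM ler_nat mulnC.
  (* Without signal the whole estimate is an error, and outside [U] it contains more than half of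
     [S]. *)
  rewrite finset.setD0 finset.set0D finset.setU0.
  have := cardsID B S; have := subset_leq_card (finset.subsetIr S B).
  lia.
have := est_prob_information U a0.
have q0 : 0 <= est_prob est XS U by exact: fine_ge0.
have ea : 1 <= expR a by rewrite -expR0 ler_expR.
move: (est_prob _ _ _) (est_prob _ _ _) (expR a) (2 * e / _) h0 hS q0 ea.
move=> p q E f *.
nra.
Qed.

End two_point_bounds.

(** * Submatrices and the asymptotic bounds *)

Section submatrices.
Variables n1 n2 s : nat.

Lemma card_submatrix (S : {set 'I_n1 * 'I_n2}) :
  S \in submatrices n1 n2 s -> #|S| = s.
Proof.
rewrite inE => /existsP[S1 /existsP[S2 /andP[/eqP -> /eqP <-]]].
exact: cardsX.
Qed.

Lemma submatrices0_set0 : finset.set0 \in submatrices0 n1 n2 s.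
Proof. by rewrite !inE eqxx. Qed.

Lemma sub_submatrices0 S :
  S \in submatrices n1 n2 s -> S \in submatrices0 n1 n2 s.
Proof. by move=> SC; rewrite /submatrices0 in_setU1 SC orbT. Qed.

End submatrices.

Section detection_budget.
Context (R : realType) (n1 n2 s : nat) (m mu : R).
Notation T := ('I_n1 * 'I_n2)%type.
Variables (K : policy R T) (X : forall S : {set T}, run K mu S).
Variable est : (nat -> datum R T) -> {set T}.
Hypothesis n_gt0 : (0 < n1 * n2)%N.
Hypothesis s_gt0 : (0 < s)%N.
Hypothesis mu_ge0 : 0 <= mu.
Hypothesis est_measurable : measurable_estimator est.
Variable Q : {set {set T}}.
Hypothesis partQ : finset.partition Q [set: T]%SET.
Hypothesis subQ : Q \subset submatrices n1 n2 s.
Hypothesis budget : (expected_budget (X finset.set0) <= m%:E)%E.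

(** The two-point bound at a block receiving at most its share of the budget. It equals [mu ^+ 2]
    divided by 2 n / (s m), so bounding it below bounds the signal below. *)
Definition block_information : R := mu ^+ 2 / 2 * (m * s%:R / (n1 * n2)%:R).

Let cheap_submatrix : exists S, [/\ S \in submatrices n1 n2 s, #|S| = s,
  S != finset.set0 &
  (\int[run_prob (X finset.set0)]_w
     \sum_(0 <= j <oo) (precision_on S (run_act (X finset.set0) j w))%:E <=
   (m * s%:R / (n1 * n2)%:R)%:E)%E].
Proof.
have cardQ : {in Q, forall S : {set T}, #|S| = s}.
  by move=> S SQ; apply: card_submatrix; exact: (fintype.subsetP subQ).
have cardT : #|{: T}| = (n1 * n2)%N by rewrite card_prod !card_ord.
have [|S SQ] := exists_cheap_block partQ cardQ _ budget; rewrite cardT// => le.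
exists S; split => //.
- exact: (fintype.subsetP subQ).
- exact: cardQ.
- by rewrite -card_gt0 cardQ.
Qed.

(** [exact_recovery_bound] is used with a = M + 1; the assumption on [e] makes the correction at
    most 1. *)
Lemma exact_recovery_information (e M : R) : 0 <= M ->
  (\big[maxe/0%E]_(S in submatrices0 n1 n2 s) error_prob (X S) est <= e%:E)%E ->
  e * (M + 1 + expR (M + 1)) <= 1 ->
  M <= block_information.
Proof.
move=> M0 maxe_le eM.
have err S : S \in submatrices0 n1 n2 s -> (error_prob (X S) est <= e%:E)%E.
  move=> SC; apply: le_trans maxe_le.
  exact: (le_bigmax_cond _ (fun S => error_prob (X S) est)).
have [S [SC _ S0 le]] := cheap_submatrix.
have M1 : 0 <= M + 1 by rewrite addr_ge0.
have := exact_recovery_bound est_measurable mu_ge0 le M1 S0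
  (err _ (submatrices0_set0 _ _ _)) (err _ (sub_submatrices0 SC)).
by rewrite /block_information; lra.
Qed.

(** Here a = ln s + M + 1. Since exp a = s exp (M + 1), the factor 1 / s absorbs the growth in s and
    the correction is again at most 1. *)
Lemma approximate_recovery_information (e M : R) : 0 <= M ->
  (\big[maxe/0%E]_(S in submatrices0 n1 n2 s) expected_symdiff (X S) est <=
    e%:E)%E ->
  0 <= e -> 2 * e * (M + 2 + expR (M + 1)) <= 1 ->
  ln s%:R + M <= block_information.
Proof.
move=> M0 maxe_le e0 eM.
have err S : S \in submatrices0 n1 n2 s ->
    (expected_symdiff (X S) est <= e%:E)%E.
  move=> SC; apply: le_trans maxe_le.
  exact: (le_bigmax_cond _ (fun S => expected_symdiff (X S) est)).
have [S [SC cS S0 le]] := cheap_submatrix.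
have s0 : 0 < s%:R :> R by rewrite ltr0n.
have s1 : 1 <= s%:R :> R by rewrite ler1n.
have lns0 : 0 <= ln (s%:R : R) by exact: ln_ge0.
have lns : ln (s%:R : R) <= s%:R by exact/ltW/ln_sublinear.
have a0 : 0 <= ln s%:R + (M + 1) by rewrite !addr_ge0.
have := approximate_recovery_bound est_measurable mu_ge0 le a0 S0
  (err _ (submatrices0_set0 _ _ _)) (err _ (sub_submatrices0 SC)).
rewrite cS expRD lnK ?posrE// -/block_information.
apply: le_trans.
rewrite addrA -[X in X <= _](addrK 1) lerD2l lerN2.
apply: le_trans eM; rewrite -[X in X <= _]mulrA ler_wpM2l ?mulr_ge0//.
(* What is left follows from ln s + M + 1 <= (M + 2) s, as ln s <= s and 1 <= s. *)
rewrite mulrC ler_pdivrMr//.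
have := expR_ge0 (M + 1); nra.
Qed.

End detection_budget.

Lemma near_le_of_cvg0 (R : realType) (u : nat -> \bar R) (e : R) : 0 < e ->
  u @ \oo --> 0%E -> \forall k \near \oo, (u k <= e%:E)%E.
Proof.
move=> e0 u0; have e0E : (0%E < e%:E)%E by rewrite lte_fin.
have : \forall k \near \oo, (u k < e%:E)%E by exact: u0 _ (open_ereal_lt' e0E).
by apply: filterS => k /ltW.
Qed.

(** Restricts divergence to the nonnegative thresholds covered by the recovery lemmas. *)
Lemma cvgry_ge_nonneg (R : realType) (u : nat -> R) :
  (forall M, 0 <= M -> \forall k \near \oo, M <= u k) -> u @ \oo --> +oo.
Proof.
move=> h; apply/cvgryPge => M.
have := h (Num.max M 0); rewrite le_max lexx orbT => /(_ isT).
by apply: filterS => k; rewrite ge_max => /andP[].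
Qed.

Theorem corollary12 (R : realType) (n1 n2 s : nat -> nat) (m mu : nat -> R)
    (K : forall k, policy R ('I_(n1 k) * 'I_(n2 k))%type)
    (X : forall k (S : {set 'I_(n1 k) * 'I_(n2 k)}), run (K k) (mu k) S)
    (est : forall k, (nat -> datum R ('I_(n1 k) * 'I_(n2 k))%type) ->
      {set 'I_(n1 k) * 'I_(n2 k)})
    (n_infty : (fun k => n1 k * n2 k)%N @ \oo --> \oo)
    (s_ge1 : forall k, (1 <= s k)%N)
    (m_gt0 : forall k, 0 < m k)
    (mu_gt0 : forall k, 0 < mu k)
    (cover : forall k, exists2 P : {set {set 'I_(n1 k) * 'I_(n2 k)}},
      finset.partition P [set: 'I_(n1 k) * 'I_(n2 k)]%SET &
      P \subset submatrices (n1 k) (n2 k) (s k))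
    (s_littleo : (fun k => (s k)%:R : R^o) =o_\oo
                 (fun k => (n1 k * n2 k)%:R : R^o))
    (est_measurable : forall k, measurable_estimator (est k))
    (budget : forall k (S : {set 'I_(n1 k) * 'I_(n2 k)}),
      S \in submatrices0 (n1 k) (n2 k) (s k) ->
      (expected_budget (X k S) <= (m k)%:E)%E) :
  ((fun k => \big[maxe/0%E]_(S in submatrices0 (n1 k) (n2 k) (s k))
       error_prob (X k S) (est k)) @ \oo --> 0%E ->
   exists2 omega : nat -> R, omega @ \oo --> +oo &
     \forall k \near \oo,
       mu k >= omega k * Num.sqrt (2 * (n1 k * n2 k)%:R / ((s k)%:R * m k)))
  /\
  ((fun k => \big[maxe/0%E]_(S in submatrices0 (n1 k) (n2 k) (s k))
       expected_symdiff (X k S) (est k)) @ \oo --> 0%E ->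
   exists2 omega : nat -> R, omega @ \oo --> +oo &
     \forall k \near \oo,
       mu k >= Num.sqrt (2 * (n1 k * n2 k)%:R / ((s k)%:R * m k) *
                         (ln (s k)%:R + omega k))).
Proof.
pose D k := block_information (n1 k) (n2 k) (s k) (m k) (mu k).
have n_gt0 : \forall k \near \oo, (0 < n1 k * n2 k)%N.
  exact: n_infty (nbhs_infty_gt 0).
have budget0 k : (expected_budget (X k finset.set0) <= (m k)%:E)%E.
  exact/budget/submatrices0_set0.
(* The identity fails for n = 0, which happens only for finitely many k. *)
have muE k : (0 < n1 k * n2 k)%N ->
    2 * (n1 k * n2 k)%:R / ((s k)%:R * m k) * D k = mu k ^+ 2.
  move=> n0; have s0 := s_ge1 k.
  rewrite /D /block_information; field.
  move: n0; rewrite muln_gt0 !lt0n => /andP[n10 n20].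
  by rewrite !pnatr_eq0 n10 n20 -lt0n s0 gt_eqF.
have fac_ge0 k : 0 <= 2 * (n1 k * n2 k)%:R / ((s k)%:R * m k).
  by rewrite divr_ge0 ?mulr_ge0// ltW.
split=> err0.
(* For this [omega] the claim is eventually an equality by [muE]; the estimator enters only through
   the divergence of [omega]. *)
- exists (fun k => Num.sqrt (D k)); last first.
    near=> k; rewrite mulrC -sqrtrM// muE; last by near: k.
    by rewrite sqrtr_sqr ger0_norm// ltW.
  apply: cvgry_ge_nonneg => M M0.
  have M20 : 0 <= M ^+ 2 by exact: sqr_ge0.
  (* The largest error level at which [exact_recovery_information] yields the threshold [M ^+ 2] for
     [D k], hence [M] for its square root. *)
  pose e := (M ^+ 2 + 1 + expR (M ^+ 2 + 1))^-1.
  have E0 : 0 < M ^+ 2 + 1 + expR (M ^+ 2 + 1).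
    by rewrite addr_gt0 ?expR_gt0// ltr_wpDl.
  have e0 : 0 < e by rewrite invr_gt0.
  near=> k.
  have [Q partQ subQ] := cover k.
  rewrite -(ger0_norm M0) -sqrtr_sqr ler_wsqrtr//.
  apply: (@exact_recovery_information R _ _ _ _ _ (K k) (X k) (est k)
    _ _ _ _ Q _ _ _ e) => //.
  + by near: k.
  + exact: ltW.
  + near: k; exact: near_le_of_cvg0 err0.
  + by rewrite mulVf// gt_eqF.
(* The logarithms cancel, and the claim is again eventually an equality. *)
- exists (fun k => D k - ln (s k)%:R); last first.
    near=> k; rewrite addrC subrK muE; last by near: k.
    by rewrite sqrtr_sqr ger0_norm// ltW.
  apply: cvgry_ge_nonneg => M M0.
  (* The largest error level allowed by [approximate_recovery_information]; it does not depend on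
     s. *)
  pose e := (2 * (M + 2 + expR (M + 1)))^-1.
  have E0 : 0 < 2 * (M + 2 + expR (M + 1)).
    by rewrite mulr_gt0// addr_gt0 ?expR_gt0// ltr_wpDl.
  have e0 : 0 < e by rewrite invr_gt0.
  near=> k.
  have [Q partQ subQ] := cover k.
  rewrite lerBrDl.
  apply: (@approximate_recovery_information R _ _ _ _ _ (K k) (X k) (est k)
    _ _ _ _ Q _ _ _ e) => //.
  + by near: k.
  + exact: ltW.
  + near: k; exact: near_le_of_cvg0 err0.
  + exact: ltW.
  + by rewrite mulrAC mulfV// gt_eqF.
Unshelve. all: end_near.
Qed.
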